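(* Let $B>0$ and let $n\ge 1$ be a fixed integer. Let $x$ and $\rho$ be real with $0<x<B$ and $0<\rho<B$, and put $M=x^2/(4\rho)$. Then, as $M\to\infty$ (with $M>n$), $$F(x,\rho,0)=-\pi e^{-\rho/2}\sum_{r=0}^\infty \frac{(\tfrac12)_r}{r!}\,\rho^r\,\mathcal{H}_r(x)+\pi e^{\rho/2}\left\{\sum_{k=0}^{n-1}\frac{M^{-k}}{2^{2k}\,k!}\,C_k(x)+O(M^{-n})\right\}+O(e^{-M})+O(M^{-1}e^{-M}),$$ where $$F(x,\rho,0)=\int_{-\infty}^\infty e^{-\frac12\rho\cosh 2u}\cos(x\cosh u)\,du .$$
   Context: Notation. $(a)_r=\Gamma(a+r)/\Gamma(a)$ is the Pochhammer symbol. The scaled Struve function is $$\mathcal{H}_\nu(x)=(\tfrac12 x)^{-\nu}\,\mathbf{H}_\nu(x)=\sum_{k=0}^\infty\frac{(-1)^k(\tfrac12 x)^{2k+1}}{\Gamma(k+\tfrac32)\,\Gamma(k+\nu+\tfrac32)},$$ where $\mathbf{H}_\nu$ is the Struve function. The coefficients $C_k(x)$, for $x>0$ and integer $k\ge 0$, are $$C_k(x)=\frac{2}{\pi}\,x^{2k}\int_0^\infty\frac{\xi^{2k}e^{-x\xi}}{\sqrt{1+\xi^2}}\,d\xi .$$ Order symbols: each $O(g(M))$ denotes a quantity $E=E(x,\rho)$ for which there exist constants $K>0$ and $M_0>n$, depending only on $n$ and $B$, such that $|E|\le K\,g(M)$ for all $x,\rho\in(0,B)$ with $M=x^2/(4\rho)\ge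 M_0$. *)

(* Defs.v *)
(* MathComp-Analysis *)
From mathcomp Require Export all_boot all_order all_algebra.
From mathcomp Require Export all_classical all_reals all_analysis.
Export Order.TTheory GRing.Theory Num.Theory.
Export numFieldNormedType.Exports.

Set Implicit Arguments.
Unset Strict Implicit.
Unset Printing Implicit Defensive.

Local Open Scope classical_set_scope.
Local Open Scope ring_scope.

Section Definitions.
Context {R : realType}.
Local Notation mu := (@lebesgue_measure R).

Definition cosh (u : R) : R := (expR u + expR (- u)) / 2.

(* Euler's integral, which represents the Gamma function for 0 < a only. *)
Definition Gamma (a : R) : R :=
  \int[mu]_(t in `]0, +oo[) (t `^ (a - 1) * expR (- t)).

(* (a)_r, meant for 0 < a, the domain on which [Gamma] is the Gamma function. *)
Definition pochhammer (a : R) (r : nat) : R := Gamma (a + r%:R) / Gamma a.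

(* (x/2)^(-nu) H_nu(x), with H_nu the Struve function; meant for -3/2 < nu, so
   that every argument of [Gamma] is positive. *)
Definition scaled_struve (nu x : R) : R :=
  limn (series (fun k : nat =>
    (-1) ^+ k * (x / 2) ^+ (2 * k + 1) /
      (Gamma (k%:R + 3 / 2) * Gamma (k%:R + nu + 3 / 2)))).

Definition coefC (k : nat) (x : R) : R :=
  2 / pi * x ^+ (2 * k) *
  \int[mu]_(xi in `[0, +oo[)
    (xi ^+ (2 * k) * expR (- (x * xi)) / Num.sqrt (1 + xi ^+ 2)).

(* F(x, rho, 0) *)
Definition F0 (x rho : R) : R :=
  \int[mu]_u (expR (- (rho / 2 * cosh (2 * u))) * cos (x * cosh u)).

Definition bigM (x rho : R) : R := x ^+ 2 / (4 * rho).

(* E(x, rho) = O(g(M)) as M = x^2/(4 rho) -> oo, uniformly over x, rho in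
   (0, B): the constants may depend on n and B only. *)
Definition isO (n : nat) (B : R) (g : R -> R) (E : R -> R -> R) : Prop :=
  exists K M0 : R, [/\ 0 < K, n%:R < M0 &
    forall x rho : R, 0 < x < B -> 0 < rho < B -> M0 <= bigM x rho ->
      `|E x rho| <= K * g (bigM x rho)].

End Definitions.

(* Main.v *)
(* With w = u + i t, the integrand of F(x, rho, 0) is the real part on the real
   axis of the entire function g w = exp (- rho/2 cosh (2 w) + i x cosh w).
   Choose V with sinh V = x / (2 rho), so that V + i pi/2 is a saddle point, and
   apply Cauchy's theorem to g on the rectangle [0, V] x [0, pi/2].
   - On u = 0 one gets the integral of e^(rho sin^2 t) sin (x cos t), whose
     expansion in powers of rho and x is the Struve series, by Wallis' integrals.
   - On t = pi/2 the substitution xi = sinh u gives the integral over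
     [0, x / (2 rho)] of e^(rho xi^2 - x xi) / sqrt (1 + xi^2); expanding
     e^(rho xi^2) produces the C_k, and rho xi^2 <= x xi / 2 on that interval
     makes the remainder O(M^-n).
   - On u = V, |g| <= e^(rho/2 - M), and the integral of g over [V, oo[ is
     O(M^-1 e^-M).
   As e^-M = O(M^-n), all three errors can be put in the first one. *)
Require Import Defs.
From mathcomp Require Import measurable_realfun ring lra.

Set Implicit Arguments.
Unset Strict Implicit.
Unset Printing Implicit Defensive.

Local Open Scope classical_set_scope.
Local Open Scope ring_scope.

(** * Hyperbolic functions *)

Section Hyperbolic.
Context {R : realType}.
Implicit Types u v : R.

(** On t = pi/2 the kernel no longer oscillates, but it equals e^(rho/2 + rho xi^2 - x xi), which
    decreases up to xi = x / (2 rho) and grows again beyond. The contour therefore leaves that line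
    at the minimum, which is the saddle; the value there is e^(rho/2 - M) with M = rho sinh(V)^2,
    and the same M controls the side u = V and the rest of the real axis.

    Cauchy's theorem enters through its real part, so it is stated for real functions of (u, t) and
    no complex analysis appears.

    The delicate point is uniformity: x may tend to 0 while M grows, so the error bound may contain
    x and rho only through M. Bounding 1 / sqrt (1 + xi^2) by 1 would leave a factor 1/x in the
    remainder; bounding it by 1 / xi makes the powers of x and rho combine exactly into M^-n.

    The Struve sum is no approximation: it equals the contribution of the side u = 0 and cancels
    against it. Its Gamma values are all at half-integers, where they reduce to the Gauss integral
    and a recurrence. *)

Definition sinh u : R := (expR u - expR (- u)) / 2.

Lemma sinhD u v : sinh (u + v) = sinh u * cosh v + cosh u * sinh v.
Proof. by rewrite /sinh /cosh opprD !expRD; field. Qed.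

Lemma sqr_cosh u : cosh u ^+ 2 = 1 + sinh u ^+ 2.
Proof.
suff: (cosh u - sinh u) * (cosh u + sinh u) = 1.
  by rewrite -subr_sqr => <-; rewrite subrK.
have -> : cosh u - sinh u = expR (- u) by rewrite /cosh /sinh; field.
have -> : cosh u + sinh u = expR u by rewrite /cosh /sinh; field.
by rewrite -expRD addNr expR0.
Qed.

Lemma cosh_double u : cosh (2 * u) = 1 + 2 * sinh u ^+ 2.
Proof.
have -> : cosh (2 * u) = cosh u ^+ 2 + sinh u ^+ 2.
  by rewrite /cosh /sinh mulr_natl mulr2n opprD !expRD; field.
by rewrite sqr_cosh; ring.
Qed.

Lemma sinh0 : sinh 0 = 0 :> R.
Proof. by rewrite /sinh oppr0 subrr mul0r. Qed.

Lemma coshN u : cosh (- u) = cosh u.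
Proof. by rewrite /cosh opprK addrC. Qed.

Lemma norm_sinh_le_cosh u : `|sinh u| <= cosh u.
Proof.
have p := expR_gt0 u; have q := expR_gt0 (- u).
by rewrite ler_norml /sinh /cosh; apply/andP; split; lra.
Qed.

Lemma cosh_ge1 u : 1 <= cosh u.
Proof.
have p := expR_gt0 u; rewrite -(@ler_pXn2r _ 2) ?nnegrE//.
  by rewrite sqr_cosh expr1n lerDl sqr_ge0.
exact: le_trans (norm_sinh_le_cosh u).
Qed.

End Hyperbolic.

(** * Rules for continuity and derivatives, and the tactics that apply them *)

Section Calculus.
Context {R : realType}.
Implicit Types f g : R -> R.

Lemma continuous_fun_cst (c : R) : continuous (fun _ : R => c).
Proof. by move=> x; exact: cvg_cst. Qed.

Lemma continuous_fun_id : continuous (fun x : R => x).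
Proof. by move=> x; exact: cvg_id. Qed.

Lemma continuous_oppr : continuous (-%R : R -> R).
Proof. by move=> x; apply: cvgN; exact: cvg_id. Qed.

Lemma continuous_mulr (c : R) : continuous ( *%R c).
Proof. by move=> x; apply: cvgM; [exact: cvg_cst|exact: cvg_id]. Qed.

Lemma continuous_fun_add f g :
  continuous f -> continuous g -> continuous (fun x => f x + g x).
Proof. by move=> cf cg x; apply: cvgD; [exact: cf|exact: cg]. Qed.

Lemma continuous_fun_opp f : continuous f -> continuous (fun x => - f x).
Proof. by move=> cf x; apply: cvgN; exact: cf. Qed.

Lemma continuous_fun_mul f g :
  continuous f -> continuous g -> continuous (fun x => f x * g x).
Proof. by move=> cf cg x; apply: cvgM; [exact: cf|exact: cg]. Qed.

Lemma continuous_fun_exp f (n : nat) :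
  continuous f -> continuous (fun x => f x ^+ n).
Proof.
move=> cf x; apply: (@continuous_comp _ _ _ f (fun y => y ^+ n)); first exact: cf.
exact: exprn_continuous.
Qed.

Lemma continuous_fun_comp g f :
  continuous g -> continuous f -> continuous (fun x => g (f x)).
Proof.
by move=> cg cf x; apply: (@continuous_comp _ _ _ f g); [exact: cf|exact: cg].
Qed.

Lemma continuous_fun_expR f :
  continuous f -> continuous (fun x => expR (f x)).
Proof. by apply: continuous_fun_comp; exact: continuous_expR. Qed.

Lemma continuous_fun_cos f : continuous f -> continuous (fun x => cos (f x)).
Proof. by apply: continuous_fun_comp; exact: continuous_cos. Qed.

Lemma continuous_fun_sin f : continuous f -> continuous (fun x => sin (f x)).
Proof. by apply: continuous_fun_comp; exact: continuous_sin. Qed.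

Lemma continuous_fun_sqrt f :
  continuous f -> continuous (fun x => Num.sqrt (f x)).
Proof.
by apply: (@continuous_fun_comp Num.sqrt); exact: sqrt_continuous.
Qed.

Lemma continuous_fun_inv f :
  (forall x, f x != 0) -> continuous f -> continuous (fun x => (f x)^-1).
Proof. by move=> f0 cf x; apply: cvgV; [exact: f0|exact: cf]. Qed.

(** Lets [prove_derive] build the derivative in whatever form the rules give and leave its equality
    with the expected value as a goal. *)
Lemma is_derive_fun_val f (x a b : R) :
  is_derive x 1 f a -> a = b -> is_derive x 1 f b.
Proof. by move=> fa <-. Qed.

Lemma is_derive_fun_cst (c x : R) : is_derive x 1 (fun _ : R => c) 0.
Proof. exact: is_derive_cst. Qed.

Lemma is_derive_fun_id (x : R) : is_derive x 1 (fun y : R => y) 1.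
Proof. exact: is_derive_id. Qed.

Lemma is_derive_fun_add f g (x a b : R) :
  is_derive x 1 f a -> is_derive x 1 g b ->
  is_derive x 1 (fun y => f y + g y) (a + b).
Proof. by move=> fa gb; have := is_deriveD fa gb. Qed.

Lemma is_derive_fun_opp f (x a : R) :
  is_derive x 1 f a -> is_derive x 1 (fun y => - f y) (- a).
Proof. by move=> fa; have := is_deriveN fa. Qed.

Lemma is_derive_fun_mul f g (x a b : R) :
  is_derive x 1 f a -> is_derive x 1 g b ->
  is_derive x 1 (fun y => f y * g y) (a * g x + f x * b).
Proof.
move=> fa gb; have := is_deriveM fa gb.
by rewrite addrC /GRing.scale /= (mulrC (g x)).
Qed.

Lemma is_derive_oppr (x : R) : is_derive x 1 -%R (- 1).
Proof. exact: is_derive_fun_opp (is_derive_fun_id x). Qed.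

Lemma is_derive_mulr (c x : R) : is_derive x 1 ( *%R c) c.
Proof.
have := is_derive_fun_mul (is_derive_fun_cst c x) (is_derive_fun_id x).
by move/is_derive_fun_val; apply; rewrite mul0r add0r mulr1.
Qed.

Lemma is_derive_fun_exp f (n : nat) (x a : R) :
  is_derive x 1 f a ->
  is_derive x 1 (fun y => f y ^+ n) (n%:R * f x ^+ n.-1 * a).
Proof. by move=> fa; have := is_deriveX n fa; rewrite exprfctE. Qed.

Lemma is_derive_fun_comp g f (x a b : R) :
  is_derive (f x) 1 g a -> is_derive x 1 f b ->
  is_derive x 1 (fun y => g (f y)) (a * b).
Proof. by move=> ga fb; have := is_derive1_comp ga fb. Qed.

Lemma is_derive_fun_expR f (x a : R) :
  is_derive x 1 f a -> is_derive x 1 (fun y => expR (f y)) (expR (f x) * a).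
Proof. by move/(is_derive_fun_comp (is_derive_expR _)). Qed.

Lemma is_derive_fun_cos f (x a : R) :
  is_derive x 1 f a -> is_derive x 1 (fun y => cos (f y)) (- sin (f x) * a).
Proof. by move/(is_derive_fun_comp (is_derive_cos _)). Qed.

Lemma is_derive_fun_sin f (x a : R) :
  is_derive x 1 f a -> is_derive x 1 (fun y => sin (f y)) (cos (f x) * a).
Proof. by move/(is_derive_fun_comp (is_derive_sin _)). Qed.

Lemma is_derive_sinh (u : R) : is_derive u 1 sinh (cosh u).
Proof.
have d := is_derive_fun_expR (is_derive_fun_opp (is_derive_fun_id u)).
have := is_derive_fun_add (is_derive_expR u) (is_derive_fun_opp d).
move/is_derive_fun_mul/(_ (is_derive_fun_cst 2^-1 u))/is_derive_fun_val.
by apply; rewrite /cosh; ring.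
Qed.

Lemma is_derive_cosh (u : R) : is_derive u 1 cosh (sinh u).
Proof.
have d := is_derive_fun_expR (is_derive_fun_opp (is_derive_fun_id u)).
have := is_derive_fun_add (is_derive_expR u) d.
move/is_derive_fun_mul/(_ (is_derive_fun_cst 2^-1 u))/is_derive_fun_val.
by apply; rewrite /sinh; ring.
Qed.

Lemma continuous_sinh : continuous (@sinh R).
Proof.
move=> u; apply/differentiable_continuous/derivable1_diffP.
by have [] := is_derive_sinh u.
Qed.

Lemma continuous_cosh : continuous (@cosh R).
Proof.
move=> u; apply/differentiable_continuous/derivable1_diffP.
by have [] := is_derive_cosh u.
Qed.

Lemma continuous_fun_sinh f :
  continuous f -> continuous (fun x => sinh (f x)).
Proof. by apply: continuous_fun_comp; exact: continuous_sinh. Qed.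

Lemma continuous_fun_cosh f :
  continuous f -> continuous (fun x => cosh (f x)).
Proof. by apply: continuous_fun_comp; exact: continuous_cosh. Qed.

Lemma is_derive_fun_cosh f (x a : R) :
  is_derive x 1 f a -> is_derive x 1 (fun y => cosh (f y)) (sinh (f x) * a).
Proof. by move/(is_derive_fun_comp (is_derive_cosh _)). Qed.

Lemma is_derive_fun_sinh f (x a : R) :
  is_derive x 1 f a -> is_derive x 1 (fun y => sinh (f y)) (cosh (f x) * a).
Proof. by move/(is_derive_fun_comp (is_derive_sinh _)). Qed.

End Calculus.

(* The cases are selected syntactically: unification alone would match any
   function f with f ^+ 1 and loop. *)
Ltac prove_continuous :=
  repeat lazymatch goal with
  | |- continuous (fun _ => ?c) => apply continuous_fun_cst
  | |- continuous ( *%R _) => apply continuous_mulr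
  | |- continuous -%R => exact: continuous_oppr
  | |- continuous expR => exact: continuous_expR
  | |- continuous cos => exact: continuous_cos
  | |- continuous sin => exact: continuous_sin
  | |- continuous (fun _ => _ + _) => apply continuous_fun_add
  | |- continuous (fun _ => - _) => apply continuous_fun_opp
  | |- continuous (fun _ => _ * _) => apply continuous_fun_mul
  | |- continuous (fun _ => _ ^+ _) => apply continuous_fun_exp
  | |- continuous (fun _ => _^-1) => apply continuous_fun_inv
  | |- continuous (fun _ => expR _) => apply continuous_fun_expR
  | |- continuous (fun _ => cos _) => apply continuous_fun_cos
  | |- continuous (fun _ => sin _) => apply continuous_fun_sin
  | |- continuous cosh => exact: continuous_cosh
  | |- continuous sinh => exact: continuous_sinh
  | |- continuous (fun _ => cosh _) => apply continuous_fun_cosh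
  | |- continuous (fun _ => sinh _) => apply continuous_fun_sinh
  | |- continuous (fun _ => Num.sqrt _) => apply continuous_fun_sqrt
  | |- continuous _ =>
      first [assumption | exact: continuous_fun_id]
  end.

Ltac prove_derive :=
  notypeclasses refine (is_derive_fun_val _ _);
  [ repeat lazymatch goal with
    | |- is_derive _ _ (fun _ => ?c) _ =>
        notypeclasses refine (is_derive_fun_cst _ _)
    | |- is_derive _ _ ( *%R _) _ => exact: is_derive_mulr
    | |- is_derive _ _ -%R _ => exact: is_derive_oppr
    | |- is_derive _ _ expR _ => exact: is_derive_expR
    | |- is_derive _ _ cos _ => exact: is_derive_cos
    | |- is_derive _ _ sin _ => exact: is_derive_sin
    | |- is_derive _ _ (fun _ => _ + _) _ =>
        notypeclasses refine (is_derive_fun_add _ _)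
    | |- is_derive _ _ (fun _ => - _) _ =>
        notypeclasses refine (is_derive_fun_opp _)
    | |- is_derive _ _ (fun _ => _ * _) _ =>
        notypeclasses refine (is_derive_fun_mul _ _)
    | |- is_derive _ _ (fun _ => _ ^+ _) _ =>
        notypeclasses refine (is_derive_fun_exp _ _)
    | |- is_derive _ _ (fun _ => expR _) _ =>
        notypeclasses refine (is_derive_fun_expR _)
    | |- is_derive _ _ (fun _ => cos _) _ =>
        notypeclasses refine (is_derive_fun_cos _)
    | |- is_derive _ _ cosh _ => exact: is_derive_cosh
    | |- is_derive _ _ sinh _ => exact: is_derive_sinh
    | |- is_derive _ _ (fun _ => cosh _) _ =>
        notypeclasses refine (is_derive_fun_cosh _)
    | |- is_derive _ _ (fun _ => sinh _) _ =>
        notypeclasses refine (is_derive_fun_sinh _)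
    | |- is_derive _ _ (fun _ => sin _) _ =>
        notypeclasses refine (is_derive_fun_sin _)
    | |- is_derive _ _ _ _ =>
        first [ eassumption
              | notypeclasses refine (is_derive_fun_id _) ]
    end
  | rewrite /= ].

(** * Integration on segments and half-lines, with exponential bounds *)

Section Integrals.
Context {R : realType}.
Local Notation mu := (@lebesgue_measure R).
Implicit Types f F : R -> R.

Lemma continuous_measurable_EFin f (D : set R) :
  continuous f -> measurable_fun D (EFin \o f).
Proof.
move=> cf; apply/measurable_EFinP; apply: measurable_funTS.
exact: continuous_measurable_fun.
Qed.

Lemma continuous_integrable f (a b : R) :
  continuous f -> mu.-integrable `[a, b] (EFin \o f).
Proof.
move=> cf; apply: continuous_compact_integrable; first exact: segment_compact.
exact: continuous_subspaceT.
Qed.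

Lemma is_derive_continuous F f :
  (forall x : R, is_derive x 1 F (f x)) -> continuous F.
Proof.
move=> dF x; apply/differentiable_continuous/derivable1_diffP.
by have [] := dF x.
Qed.

Lemma is_derive_LRcontinuous F f (a b : R) :
  (forall x : R, is_derive x 1 F (f x)) -> derivable_oo_LRcontinuous F a b.
Proof.
move=> dF; have cF := is_derive_continuous dF; split.
- by move=> x _; have [] := dF x.
- by apply: cvg_at_right_filter; exact: cF.
- by apply: cvg_at_left_filter; exact: cF.
Qed.

Lemma is_derive_derive1 F f :
  (forall x : R, is_derive x 1 F (f x)) -> F^`()%classic = f.
Proof.
by move=> dF; apply/funext => x; rewrite derive1E; have [_ ->] := dF x.
Qed.

Lemma Rintegral_FTC F f (a b : R) : a <= b -> continuous f ->
  (forall x : R, is_derive x 1 F (f x)) ->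
  \int[mu]_(x in `[a, b]) f x = F b - F a.
Proof.
rewrite le_eqVlt => /predU1P[<-|ab] cf dF.
  by rewrite set_itv1 Rintegral_set1 subrr.
rewrite /Rintegral (@continuous_FTC2 _ f F)//.
- exact: continuous_subspaceT.
- exact: is_derive_LRcontinuous.
- by move=> x _; rewrite (is_derive_derive1 dF).
Qed.

Lemma Rintegral_itvy_split f (a b : R) : a <= b ->
  mu.-integrable `[a, +oo[ (EFin \o f) ->
  \int[mu]_(x in `[a, +oo[) f x =
  \int[mu]_(x in `[a, b]) f x + \int[mu]_(x in `[b, +oo[) f x.
Proof.
move=> ab fi; have := @Rintegral_itvB _ f (BLeft a) +oo%O b fi.
rewrite !bnd_simp => /(_ ab erefl); rewrite Rintegral_itv_obnd_cbnd; last first.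
  by apply: integrableS fi => //; apply: subset_itvr; rewrite bnd_simp.
by move=> <-; rewrite addrC subrK.
Qed.

Lemma integral_expR_tail (a c : R) : 0 < a ->
  (\int[mu]_(u in `[c, +oo[) (expR (- (a * (u - c))))%:E = (a^-1)%:E)%E.
Proof.
move=> a0; pose G u := - (a^-1 * expR (- (a * (u - c)))).
have a0' : a != 0 by rewrite gt_eqF.
have dG (u : R) : is_derive u 1 G (expR (- (a * (u - c)))).
  by rewrite /G; prove_derive; field.
rewrite (@ge0_continuous_FTC2y _ _ G c 0).
- by rewrite /G subrr mulr0 oppr0 expR0 mulr1 sub0e EFinN oppeK.
- by move=> u _; exact: expR_ge0.
- by apply: continuous_subspaceT; prove_continuous.
- rewrite /G -[X in _ --> X]oppr0 -(mulr0 a^-1); apply: cvgN; apply: cvgM.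
    exact: cvg_cst.
  apply: (cvg_comp (fun u => a * (u - c)) (fun v => expR (- v))).
    apply: gt0_cvgMry => //.
    by apply: (cvg_trans _ (cvg_addrr (- c))).
  exact: cvgr_expR.
- by move=> u _; have [] := dG u.
- by apply: cvg_at_right_filter; exact: (is_derive_continuous dG).
- by move=> u _; rewrite (is_derive_derive1 dG).
Qed.

Lemma integrable_expR_tail (a c : R) : 0 < a ->
  mu.-integrable `[c, +oo[ (EFin \o (fun u => expR (- (a * (u - c))))).
Proof.
move=> a0; apply/integrableP; split.
  by apply: continuous_measurable_EFin; prove_continuous.
rewrite (_ : integral _ _ _ = (a^-1)%:E) ?ltry// -(integral_expR_tail c a0).
by apply: eq_integral => u _; rewrite /= ger0_norm ?expR_ge0.
Qed.

Lemma expR_dominated f (a c C : R) : 0 < a -> continuous f ->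
  (forall u, c <= u -> `|f u| <= C * expR (- (a * (u - c)))) ->
  mu.-integrable `[c, +oo[ (EFin \o f) /\
  `|\int[mu]_(u in `[c, +oo[) f u| <= C / a.
Proof.
move=> a0 cf fC.
have ig : mu.-integrable `[c, +oo[
    (EFin \o (fun u => C * expR (- (a * (u - c))))).
  under [X in integrable _ _ X]eq_fun do rewrite /= EFinM.
  exact: (integrableZl _ _ (integrable_expR_tail c a0)).
have mf : measurable_fun `[c, +oo[ (EFin \o f) by exact: continuous_measurable_EFin.
have fi : mu.-integrable `[c, +oo[ (EFin \o f).
  apply: le_integrable ig => // u; rewrite /= in_itv /= andbT => cu.
  by rewrite lee_fin (le_trans (fC u cu))// ler_norm.
split=> //; apply: le_trans (le_normr_Rintegral _ fi) _ => //.
have -> : C / a = \int[mu]_(u in `[c, +oo[) (C * expR (- (a * (u - c)))).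
  rewrite RintegralZl//; last exact: integrable_expR_tail.
  by rewrite /Rintegral integral_expR_tail.
apply: le_Rintegral => //.
- exact: (integrable_norm fi).
- by move=> u; rewrite /= in_itv /= andbT => cu; exact: fC.
Qed.

(** The bound is that of the whole half-line, so it does not see the length [b]. This matters for
    the segment up to x / (2 rho), whose length is not controlled by M. *)
Lemma expR_dominated_itv f (a b C : R) : 0 < a -> 0 <= b -> continuous f ->
  (forall u, 0 <= u <= b -> `|f u| <= C * expR (- (a * u))) ->
  `|\int[mu]_(u in `[0, b]) f u| <= C / a.
Proof.
move=> a0 b0 cf fC.
have C0 : 0 <= C.
  have := fC 0; rewrite lexx b0 mulr0 oppr0 expR0 mulr1 => /(_ erefl).
  exact: le_trans.
have fi : mu.-integrable `[0, b] (EFin \o f) by exact: continuous_integrable.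
have cg : continuous (fun u => C * expR (- (a * u))) by prove_continuous.
apply: le_trans (le_normr_Rintegral _ fi) _ => //.
apply: (@le_trans _ _ (\int[mu]_(u in `[0, b]) (C * expR (- (a * u))))).
  apply: le_Rintegral => //.
  - exact: (integrable_norm fi).
  - exact: continuous_integrable.
have dG (u : R) : is_derive u 1 (fun u => - (C / a * expR (- (a * u))))
    (C * expR (- (a * u))).
  by prove_derive; field; rewrite gt_eqF.
rewrite (Rintegral_FTC b0 cg dG) mulr0 oppr0 expR0 mulr1 opprK addrC lerBlDr lerDl.
by rewrite mulr_ge0 ?expR_ge0// divr_ge0 ?(ltW a0).
Qed.

Lemma Rintegral_bounded f (a b C : R) : a <= b -> continuous f ->
  (forall u, a <= u <= b -> `|f u| <= C) ->
  `|\int[mu]_(u in `[a, b]) f u| <= C * (b - a).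
Proof.
move=> ab cf fC.
have fi : mu.-integrable `[a, b] (EFin \o f) by exact: continuous_integrable.
apply: le_trans (le_normr_Rintegral _ fi) _ => //.
have -> : C * (b - a) = \int[mu]_(u in `[a, b]) C.
  rewrite Rintegral_cst//= lebesgue_measure_itv/= lte_fin.
  by case: ltgtP ab => // -> _; rewrite subrr.
apply: le_Rintegral => //.
- exact: (integrable_norm fi).
- by apply: continuous_integrable; exact: continuous_fun_cst.
Qed.

Lemma Rintegral_sum (D : set R) (h : nat -> R -> R) (n : nat) : measurable D ->
  (forall k, mu.-integrable D (EFin \o h k)) ->
  \int[mu]_(u in D) (\sum_(0 <= k < n) h k u) =
  \sum_(0 <= k < n) \int[mu]_(u in D) h k u.
Proof.
move=> mD hi; rewrite /Rintegral.
under eq_integral do rewrite -sumEFin.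
rewrite integral_sum// sum_fine// => k _.
by apply: integrable_fin_num => //; exact: hi.
Qed.

End Integrals.

(** * Cauchy's theorem on a rectangle, in real form *)

Section Rectangle.
Context {R : realType}.
Local Notation mu := (@lebesgue_measure R).

(** For P + i Q holomorphic, [D] is the common value of the u-derivative of Q and minus the
    t-derivative of P. Hence the t-derivative of the integral of P over [0, V] is minus the integral
    of [D], that is Q 0 t - Q V t, and it remains to integrate in t. The bound [C] justifies
    differentiating under the integral sign. *)
Lemma rectangle_Rintegral (P D Q : R -> R -> R) (V a b C : R) :
  0 <= V -> a <= b ->
  (forall u t : R, is_derive t 1 (P u) (- D u t)) ->
  (forall u t : R, is_derive u 1 (Q ^~ t) (D u t)) ->
  (forall t, continuous (P ^~ t)) -> (forall t, continuous (D ^~ t)) ->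
  (forall u, continuous (Q u)) ->
  (forall u t, 0 <= u <= V -> `|D u t| <= C) ->
  \int[mu]_(u in `[0, V]) P u b - \int[mu]_(u in `[0, V]) P u a =
  \int[mu]_(t in `[a, b]) (Q 0 t - Q V t).
Proof.
move=> V0 ab dP dQ cP cD cQ DC.
pose Phi t := \int[mu]_(u in `[0, V]) P u t.
have C0 : 0 <= C by rewrite (le_trans _ (DC 0 0 _))// lexx.
have PE u t : (partial1of2 (fun t u => P u t)) t u = - D u t.
  by rewrite /partial1of2 derive1E; have [_ ->] := dP u t.
have dPhi (t : R) : is_derive t 1 Phi (Q 0 t - Q V t).
  (* Differentiation under the integral takes place on an open interval around t; its radius is
     arbitrary because [C] bounds [D] for every t. *)
  have It : `]t - 1, t + 1[%classic t.
    by rewrite /= in_itv /=; apply/andP; split; lra.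
  have Pi s : `]t - 1, t + 1[%classic s ->
      mu.-integrable `[0, V] (EFin \o (fun u => P u s)).
    by move=> _; apply: continuous_integrable; exact: cP.
  have Pd s u : `]t - 1, t + 1[%classic s -> `[0, V]%classic u ->
      derivable ((fun t u => P u t) ^~ u) s 1.
    by move=> _ _; have [] := dP u s.
  have Ci : mu.-integrable `[0, V] (EFin \o (fun _ => C)).
    by apply: continuous_integrable; exact: continuous_fun_cst.
  have PC s u : `]t - 1, t + 1[%classic s -> `[0, V]%classic u ->
      `|partial1of2 (fun t u => P u t) s u| <= C.
    by rewrite PE normrN /= !in_itv /= => _ ?; exact: DC.
  have mI : measurable (`[0, V]%classic : set R) by [].
  apply: DeriveDef.
    exact: (@derivable_under_integral _ _ _ mu (fun t u => P u t) _ mI t _ _ It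
      Pi Pd _ (fun=> C0) Ci PC).
  rewrite -derive1E /Phi.
  rewrite (@differentiation_under_integral _ _ _ mu (fun t u => P u t) _ mI t
    _ _ It Pi Pd _ (fun=> C0) Ci PC).
  transitivity (\int[mu]_(u in `[0, V]) (- D u t)).
    by apply: eq_Rintegral => u _; rewrite PE.
  rewrite (@Rintegral_FTC _ (fun u => - Q u t))//.
  - by rewrite opprK addrC.
  - by apply: continuous_fun_opp; exact: cD.
have cQV : continuous (fun t => Q 0 t - Q V t).
  by apply: continuous_fun_add; [exact: cQ|apply: continuous_fun_opp; exact: cQ].
by rewrite (Rintegral_FTC ab cQV dPhi).
Qed.

End Rectangle.

(** * Even functions on the whole line *)

Section EvenIntegral.
Context {R : realType}.
Local Notation mu := (@lebesgue_measure R).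
Local Open Scope ereal_scope.

(** Positive and negative parts of an even function are even and nonnegative, so each integral is
    twice that over the half-line; integrability makes both finite, so that they can be
    subtracted. *)
Lemma even_RintegralT (f : R -> R) : continuous f -> f =1 f \o -%R ->
  mu.-integrable `[0%R, +oo[ (EFin \o f) ->
  (\int[mu]_x f x = 2 * \int[mu]_(x in `[0, +oo[) f x)%R.
Proof.
move=> cf ef fi.
have posE : [set x : R | (0 <= x)%R] = `[0%R, +oo[%classic.
  by apply/seteqP; split => x /=; rewrite in_itv /= andbT.
have cmax (g : R -> R) : continuous g -> continuous (fun x => Num.max (g x) 0%R).
  by move=> cg x; apply: continuous_max; [exact: cg|exact: cvg_cst].
have cp := cmax _ cf.
have cn := cmax _ (continuous_fun_opp cf).
have half (g : R -> R) : continuous g -> (forall x, 0 <= g x)%R ->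
    g =1 g \o -%R ->
    \int[mu]_x (g x)%:E = 2%:E * \int[mu]_(x in `[0%R, +oo[) (g x)%:E.
  by move=> cg g0 eg; rewrite ge0_symfun_integralT// posE.
have pE (D : set R) : \int[mu]_(x in D) (EFin \o f)^\+ x =
    \int[mu]_(x in D) (Num.max (f x) 0%R)%:E.
  by apply: eq_integral => x _; rewrite funeposE /= EFin_max.
have nE (D : set R) : \int[mu]_(x in D) (EFin \o f)^\- x =
    \int[mu]_(x in D) (Num.max (- f x) 0%R)%:E.
  by apply: eq_integral => x _; rewrite funenegE /= EFin_max.
rewrite /Rintegral integralE [in RHS]integralE !pE !nE.
have max_ge0 (r : R) : (0 <= Num.max r 0)%R by rewrite le_max lexx orbT.
rewrite half//; last by move=> x /=; rewrite ef.
rewrite half//; last by move=> x /=; rewrite ef.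
have fp : \int[mu]_(x in `[0%R, +oo[) (Num.max (f x) 0%R)%:E \is a fin_num.
  by rewrite -pE integrable_pos_fin_num.
have fn : \int[mu]_(x in `[0%R, +oo[) (Num.max (- f x) 0%R)%:E \is a fin_num.
  by rewrite -nE integrable_neg_fin_num.
by rewrite -(fineK fp) -(fineK fn) -!EFinM -!EFinB /= mulrBr.
Qed.

End EvenIntegral.

(** * The kernel and its integrals over the sides of the rectangle *)

Section Contour.
Context {R : realType}.
Local Notation mu := (@lebesgue_measure R).
Variables x rho : R.
Hypotheses (x0 : 0 < x) (rho0 : 0 < rho).

(* With w = u + i t, [re_phase] and [im_phase] are the real and imaginary parts
   of - rho/2 cosh (2 w) + i x cosh w, and [re_kernel] and [im_kernel] those of
   its exponential. *)
Definition re_phase (u t : R) :=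
  - (rho / 2 * cosh (2 * u) * cos (2 * t)) - x * sinh u * sin t.
Definition im_phase (u t : R) :=
  - (rho / 2 * sinh (2 * u) * sin (2 * t)) + x * cosh u * cos t.
Definition re_kernel (u t : R) := expR (re_phase u t) * cos (im_phase u t).
Definition im_kernel (u t : R) := expR (re_phase u t) * sin (im_phase u t).

Definition du_re_phase (u t : R) :=
  - (rho * sinh (2 * u) * cos (2 * t)) - x * cosh u * sin t.
Definition du_im_phase (u t : R) :=
  - (rho * cosh (2 * u) * sin (2 * t)) + x * sinh u * cos t.
Definition du_im_kernel (u t : R) :=
  expR (re_phase u t) *
    (du_re_phase u t * sin (im_phase u t) +
     du_im_phase u t * cos (im_phase u t)).

(* Cauchy-Riemann: the same function is minus the t-derivative of [re_kernel]
   and the u-derivative of [im_kernel]. *)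
Lemma is_derive_re_kernel (u t : R) :
  is_derive t 1 (re_kernel u) (- du_im_kernel u t).
Proof.
rewrite /re_kernel /du_im_kernel /re_phase /im_phase /du_re_phase /du_im_phase.
by prove_derive; field.
Qed.

Lemma is_derive_im_kernel (u t : R) :
  is_derive u 1 (im_kernel ^~ t) (du_im_kernel u t).
Proof.
rewrite /im_kernel /du_im_kernel /re_phase /im_phase /du_re_phase /du_im_phase.
by prove_derive; field.
Qed.

Lemma norm_im_kernel (u t : R) : `|im_kernel u t| <= expR (re_phase u t).
Proof.
rewrite /im_kernel normrM ger0_norm ?expR_ge0//.
by rewrite ler_piMr ?expR_ge0// ler_norml sin_geN1 sin_le1.
Qed.

Lemma norm_re_kernel (u t : R) : `|re_kernel u t| <= expR (re_phase u t).
Proof.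
rewrite /re_kernel normrM ger0_norm ?expR_ge0//.
by rewrite ler_piMr ?expR_ge0// ler_norml cos_geN1 cos_le1.
Qed.

(** The domination required by [rectangle_Rintegral]. It is uniform in t because t enters through
    sines and cosines only; e^(2 V) covers [cosh] and [sinh] at both u and 2 u. *)
Lemma du_im_kernel_bounded (V : R) : exists C : R, forall u t : R,
  0 <= u <= V -> `|du_im_kernel u t| <= C.
Proof.
pose K := expR (2 * V).
have coshK u : 0 <= u <= 2 * V -> `|cosh u| <= K.
  move=> /andP[u0 uV]; rewrite ger0_norm ?(le_trans _ (cosh_ge1 u))//.
  have : expR u <= K by rewrite ler_expR.
  have : expR (- u) <= expR u by rewrite ler_expR; lra.
  by rewrite /cosh; lra.
have sinhK u : 0 <= u <= 2 * V -> `|sinh u| <= K.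
  move=> uV; apply: le_trans (norm_sinh_le_cosh u) _.
  exact: le_trans (ler_norm _) (coshK u uV).
have K0 : 0 <= K by exact: expR_ge0.
have cos1 (t : R) : `|cos t| <= 1 by rewrite ler_norml cos_geN1 cos_le1.
have sin1 (t : R) : `|sin t| <= 1 by rewrite ler_norml sin_geN1 sin_le1.
have term (c h s : R) : 0 <= c -> `|h| <= K -> `|s| <= 1 -> `|c * h * s| <= c * K.
  move=> c0 hK s1; rewrite -[leRHS]mulr1 normrM ler_pM//.
  by rewrite normrM (ger0_norm c0) ler_wpM2l.
exists (expR (rho / 2 * K + x * K) *
  ((rho * K + x * K) * 1 + (rho * K + x * K) * 1)).
move=> u t uV.
have u1 : 0 <= u <= 2 * V by lra.
have u2 : 0 <= 2 * u <= 2 * V by lra.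
rewrite /du_im_kernel normrM ger0_norm ?expR_ge0// ler_pM ?expR_ge0//.
  rewrite ler_expR; apply: le_trans (ler_norm _) _.
  apply: le_trans (ler_normB _ _) _; rewrite normrN.
  by rewrite lerD ?term ?coshK ?sinhK// ?divr_ge0 ?ltW.
apply: le_trans (ler_normD _ _) _; rewrite lerD// normrM ler_pM//.
  apply: le_trans (ler_normB _ _) _; rewrite normrN.
  by rewrite lerD ?term ?coshK ?sinhK// ?ltW.
apply: le_trans (ler_normD _ _) _; rewrite normrN.
by rewrite lerD ?term ?coshK ?sinhK// ?ltW.
Qed.

Lemma continuous_re_kernel_u (t : R) : continuous (re_kernel ^~ t).
Proof. by rewrite /re_kernel /re_phase /im_phase; prove_continuous. Qed.

Lemma continuous_im_kernel_t (u : R) : continuous (im_kernel u).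
Proof. by rewrite /im_kernel /re_phase /im_phase; prove_continuous. Qed.

Lemma continuous_du_im_kernel_u (t : R) : continuous (du_im_kernel ^~ t).
Proof.
rewrite /du_im_kernel /du_re_phase /du_im_phase /re_phase /im_phase.
by prove_continuous.
Qed.

Lemma re_kernel0 (u : R) :
  re_kernel u 0 = expR (- (rho / 2 * cosh (2 * u))) * cos (x * cosh u).
Proof.
rewrite /re_kernel /re_phase /im_phase mulr0 sin0 cos0.
by congr (expR _ * cos _); ring.
Qed.

(** The imaginary phase vanishes on this side, since sin (2 t) and cos t are both 0 at t = pi/2. *)
Lemma re_kernel_pihalf (u : R) :
  re_kernel u (pi / 2) = expR (rho / 2) * expR (rho * sinh u ^+ 2 - x * sinh u).
Proof.
rewrite /re_kernel /re_phase /im_phase.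
have -> : 2 * (pi / 2) = pi :> R by field.
rewrite sinpi cospi sin_pihalf cos_pihalf !mulr0 oppr0 add0r cos0 mulr1.
rewrite cosh_double -expRD.
by congr expR; field.
Qed.

Lemma im_kernel0 (t : R) : im_kernel 0 t =
  expR (- (rho / 2)) * (expR (rho * sin t ^+ 2) * sin (x * cos t)).
Proof.
have c0 : cosh 0 = 1 :> R.
  by rewrite /cosh oppr0 expR0 -mulr2n -mulr_natl mulr1 divff.
rewrite /im_kernel /re_phase /im_phase !mulr0 sinh0 c0 mulrA -expRD.
congr (expR _ * sin _); last by ring.
by rewrite mulr_natl cos_mulr2n -mulr_natl cos2sin2; field.
Qed.

Lemma contour_identity (V : R) : 0 <= V ->
  \int[mu]_(u in `[0, V]) re_kernel u 0 =
  expR (rho / 2) *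
    \int[mu]_(u in `[0, V]) expR (rho * sinh u ^+ 2 - x * sinh u)
  - expR (- (rho / 2)) *
    \int[mu]_(t in `[0, pi / 2]) (expR (rho * sin t ^+ 2) * sin (x * cos t))
  + \int[mu]_(t in `[0, pi / 2]) im_kernel V t.
Proof.
move=> V0; have [C DC] := du_im_kernel_bounded V.
have pi20 : 0 <= pi / 2 :> R by rewrite divr_ge0 ?pi_ge0.
have := rectangle_Rintegral V0 pi20 is_derive_re_kernel is_derive_im_kernel
  continuous_re_kernel_u continuous_du_im_kernel_u continuous_im_kernel_t DC.
rewrite RintegralB//; last 2 first.
- by apply: continuous_integrable; exact: continuous_im_kernel_t.
- by apply: continuous_integrable; exact: continuous_im_kernel_t.
have -> : \int[mu]_(u in `[0, V]) re_kernel u (pi / 2) = expR (rho / 2) *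
    \int[mu]_(u in `[0, V]) expR (rho * sinh u ^+ 2 - x * sinh u).
  rewrite -RintegralZl//; last by apply: continuous_integrable; prove_continuous.
  by apply: eq_Rintegral => u _; rewrite re_kernel_pihalf.
have -> : \int[mu]_(t in `[0, pi / 2]) im_kernel 0 t = expR (- (rho / 2)) *
    \int[mu]_(t in `[0, pi / 2]) (expR (rho * sin t ^+ 2) * sin (x * cos t)).
  rewrite -RintegralZl//; last by apply: continuous_integrable; prove_continuous.
  by apply: eq_Rintegral => t _; rewrite im_kernel0.
by move=> h; lra.
Qed.

End Contour.

(** * Estimates at the saddle, and F as a saddle integral plus a small error *)

Section Expansion.
Context {R : realType}.
Local Notation mu := (@lebesgue_measure R).
Variables x rho V : R.
Hypotheses (x0 : 0 < x) (rho0 : 0 < rho) (V0 : 0 <= V).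
Hypothesis saddleV : sinh V = x / (2 * rho).
Let M := bigM x rho.

Let sinhV0 : 0 < sinh V.
Proof. by rewrite saddleV divr_gt0 ?mulr_gt0. Qed.

Let xE : x = 2 * rho * sinh V.
Proof. by rewrite saddleV; field; rewrite gt_eqF. Qed.

Let ME : M = rho * sinh V ^+ 2.
Proof. by rewrite /M /bigM saddleV; field; rewrite gt_eqF. Qed.

(** On u = V the modulus is largest at the saddle t = pi/2. With s = sin t, the right side minus the
    left is rho (1 - s^2) + 2 M s (1 - s), and both terms are nonnegative. *)
Lemma re_phase_arc (t : R) : 0 <= t <= pi / 2 ->
  re_phase x rho V t <= rho / 2 - M.
Proof.
move=> /andP[t0 tpi].
have s0 : 0 <= sin t.
  by apply: sin_ge0_pi; have := pi_ge0 R; lra.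
have s1 := sin_le1 t.
have c2 : cos (2 * t) = 1 - 2 * sin t ^+ 2.
  by rewrite mulr_natl cos_mulr2n -mulr_natl cos2sin2; ring.
rewrite /re_phase ME cosh_double c2 {1}xE.
rewrite -subr_ge0 [X in 0 <= X](_ : _ = rho * ((1 - sin t) * (1 + sin t)) +
  2 * (rho * sinh V ^+ 2) * (sin t * (1 - sin t))); last by field.
have s2 : 0 <= 1 - sin t by lra.
have s3 : 0 <= 1 + sin t by lra.
have q0 : 0 <= rho * sinh V ^+ 2 by rewrite mulr_ge0 ?sqr_ge0 ?(ltW rho0).
have r0 := ltW rho0.
by rewrite addr_ge0//; apply: mulr_ge0 => //; apply: mulr_ge0.
Qed.

Lemma im_kernel_arc :
  `|\int[mu]_(t in `[0, pi / 2]) im_kernel x rho V t| <=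
  expR (rho / 2 - M) * (pi / 2).
Proof.
have pi20 : 0 <= pi / 2 :> R by rewrite divr_ge0 ?pi_ge0.
have := @Rintegral_bounded _ (im_kernel x rho V) 0 (pi / 2) (expR (rho / 2 - M)).
rewrite subr0; apply=> //; first exact: continuous_im_kernel_t.
move=> t tpi; apply: le_trans (norm_im_kernel _ _ _ _) _.
by rewrite ler_expR re_phase_arc.
Qed.

(** With d = u - V, the addition formula and cosh V >= sinh V give sinh u >= sinh V (cosh d + sinh
    d) = sinh V e^d, and e^d >= 1 + d. *)
Lemma sinh_ge (u : R) : V <= u -> sinh V * (1 + (u - V)) <= sinh u.
Proof.
move=> Vu; rewrite -{2}(subrK V u) sinhD.
have s0 : 0 <= sinh (u - V).
  by rewrite /sinh divr_ge0// subr_ge0 ler_expR; lra.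
have cs : sinh V <= cosh V.
  by apply: le_trans (norm_sinh_le_cosh V); exact: ler_norm.
apply: (@le_trans _ _ (sinh V * (cosh (u - V) + sinh (u - V)))).
  have -> : cosh (u - V) + sinh (u - V) = expR (u - V).
    by rewrite /cosh /sinh; field.
  by rewrite ler_wpM2l ?(ltW sinhV0)// expR_ge1Dx.
by have := ler_wpM2r s0 cs; lra.
Qed.

(** On the real axis the phase is - rho/2 - rho sinh(u)^2. Squaring [sinh_ge] makes it decrease at
    linear rate 2 M, and this rate is the source of the factor M^-1 in the tail. *)
Lemma re_phase_tail (u : R) : V <= u ->
  re_phase x rho u 0 <= - (rho / 2) - M - 2 * M * (u - V).
Proof.
move=> Vu; rewrite /re_phase mulr0 sin0 cos0 cosh_double ME.
have h := sinh_ge Vu.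
have h2 : sinh V ^+ 2 * (1 + 2 * (u - V)) <= sinh u ^+ 2.
  apply: (@le_trans _ _ ((sinh V * (1 + (u - V))) ^+ 2)).
    rewrite [leRHS]exprMn ler_wpM2l ?sqr_ge0//.
    by have := sqr_ge0 (u - V); lra.
  have Vu0 : 0 <= u - V by lra.
  have l0 : 0 <= sinh V * (1 + (u - V)).
    by rewrite mulr_ge0 ?(ltW sinhV0)// addr_ge0.
  by rewrite ler_pXn2r// nnegrE// (le_trans l0).
have := ler_wpM2l (ltW rho0) h2.
by rewrite mulr0 subr0; lra.
Qed.

Lemma re_kernel_integrable : mu.-integrable `[0, +oo[ (EFin \o re_kernel x rho ^~ 0).
Proof.
have [] // := @expR_dominated _ (re_kernel x rho ^~ 0) (rho / 2) 0 1.
- by rewrite divr_gt0.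
- exact: continuous_re_kernel_u.
move=> u u0; apply: le_trans (norm_re_kernel _ _ _ _) _.
rewrite mul1r subr0 ler_expR /re_phase mulr0 sin0 cos0 mulr0 subr0 mulr1 lerN2.
rewrite ler_wpM2l ?divr_ge0 ?ltW//.
(* Integrability is all that is wanted here, so the crude inequality cosh (2 u) >= u is enough. *)
have h1 := expR_ge1Dx (2 * u); have h2 := expR_gt0 (- (2 * u)).
by rewrite /cosh; lra.
Qed.

Lemma re_kernel_tail :
  `|\int[mu]_(u in `[V, +oo[) re_kernel x rho u 0| <=
  expR (- (rho / 2) - M) / (2 * M).
Proof.
have M0 : 0 < 2 * M by rewrite mulr_gt0// ME mulr_gt0// exprn_gt0.
have [] // := @expR_dominated _ (re_kernel x rho ^~ 0) (2 * M) V
  (expR (- (rho / 2) - M)) M0.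
- exact: continuous_re_kernel_u.
move=> u u0; apply: le_trans (norm_re_kernel _ _ _ _) _.
by rewrite -expRD ler_expR re_phase_tail.
Qed.

Lemma Rintegral_sinh (G : R -> R) : continuous G ->
  \int[mu]_(u in `[0, V]) G (sinh u) =
  \int[mu]_(xi in `[0, sinh V]) (G xi / Num.sqrt (1 + xi ^+ 2)).
Proof.
move=> cG; rewrite -{1}sinh0.
pose H xi := G xi / Num.sqrt (1 + xi ^+ 2).
have s0 (xi : R) : Num.sqrt (1 + xi ^+ 2) != 0.
  by rewrite sqrtr_eq0 -ltNge ltr_pwDl// sqr_ge0.
have cH : continuous H by rewrite /H; prove_continuous.
have dS := @is_derive_sinh R.
have dSE : (@sinh R)^`()%classic = cosh := is_derive_derive1 dS.
have cc := @continuous_cosh R.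
have := @integration_by_substitution_increasing R sinh H 0 V V0.
rewrite dSE => subst; rewrite /Rintegral; congr fine.
rewrite sinh0 in subst *; rewrite subst.
- apply: eq_integral => u _; congr EFin.
  change (G (sinh u) = H (sinh u) * cosh u).
  rewrite /H -sqr_cosh sqrtr_sqr ger0_norm ?(le_trans _ (cosh_ge1 u))//.
  by rewrite divfK// gt_eqF// (lt_le_trans _ (cosh_ge1 u)).
- move=> u v _ _ uv; rewrite /sinh ltr_pM2r ?invr_gt0//.
  by rewrite ltrB// ltr_expR// ltrN2.
- by move=> u _; exact: cc.
- by apply/cvg_ex; exists (cosh 0); apply: cvg_at_right_filter; exact: cc.
- by apply/cvg_ex; exists (cosh V); apply: cvg_at_left_filter; exact: cc.
- exact: is_derive_LRcontinuous dS.
- exact: continuous_subspaceT.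
Qed.

(** In the bound on [E], [pi / 2] is the length of the side u = V and [(2 * M)^-1] comes from the
    tail on the real axis. The tail carries e^(- rho/2), weakened to e^(rho/2) so that one common
    factor remains to be divided out later. *)
Lemma F0_saddle : exists2 E : R,
  `|E| <= expR (rho / 2) * expR (- M) * (pi / 2 + (2 * M)^-1) &
  F0 x rho = 2 * (expR (rho / 2) *
    \int[mu]_(xi in `[0, x / (2 * rho)])
      (expR (rho * xi ^+ 2 - x * xi) / Num.sqrt (1 + xi ^+ 2))
    - expR (- (rho / 2)) *
    \int[mu]_(t in `[0, pi / 2]) (expR (rho * sin t ^+ 2) * sin (x * cos t))
    + E).
Proof.
exists (\int[mu]_(t in `[0, pi / 2]) im_kernel x rho V t +
        \int[mu]_(u in `[V, +oo[) re_kernel x rho u 0).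
  apply: le_trans (ler_normD _ _) _; rewrite mulrDr lerD//.
    by rewrite -expRD; exact: im_kernel_arc.
  apply: le_trans re_kernel_tail _.
  have M0 : 0 < M by rewrite ME mulr_gt0// exprn_gt0.
  apply: ler_wpM2r; first by rewrite invr_ge0 mulr_ge0 ?(ltW M0).
  by rewrite -expRD ler_expR; move: rho0; lra.
have -> : F0 x rho = \int[mu]_u re_kernel x rho u 0.
  by apply: eq_Rintegral => u _; rewrite re_kernel0.
rewrite even_RintegralT; last 3 first.
- exact: continuous_re_kernel_u.
- by move=> u; rewrite /= !re_kernel0 mulrN !coshN.
- exact: re_kernel_integrable.
rewrite (Rintegral_itvy_split V0 re_kernel_integrable).
rewrite contour_identity//.
have := @Rintegral_sinh (fun xi => expR (rho * xi ^+ 2 - x * xi)).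
rewrite -saddleV => ->; last by prove_continuous.
ring.
Qed.

End Expansion.

(** * Truncating the exponential under the saddle integral *)

Section Remainder.
Context {R : realType}.
Local Notation mu := (@lebesgue_measure R).

Definition expR_trunc (n : nat) (y : R) : R := \sum_(0 <= k < n) y ^+ k / k`!%:R.

Lemma cvg_expR_trunc (y : R) : expR_trunc n y @[n --> \oo] --> expR y.
Proof.
have -> : expR_trunc ^~ y = series (exp_coeff y).
  by apply/funext => n; apply: eq_bigr => k _; rewrite exp_coeffE mulrC.
exact: is_cvg_series_exp_coeff.
Qed.

Lemma continuous_expR_trunc (f : R -> R) (n : nat) :
  continuous f -> continuous (fun u => expR_trunc n (f u)).
Proof.
move=> cf; elim: n => [|n IH].
  rewrite (_ : (fun _ => _) = fun=> 0); first exact: continuous_fun_cst.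
  by apply/funext => u; rewrite /expR_trunc big_nil.
rewrite (_ : (fun _ => _) =
  fun u => expR_trunc n (f u) + f u ^+ n / n`!%:R); first by prove_continuous.
by apply/funext => u; rewrite /expR_trunc big_nat_recr.
Qed.

Lemma expR_trunc_ge0 (n : nat) (y : R) : 0 <= y -> 0 <= expR_trunc n y.
Proof.
by move=> y0; apply: sumr_ge0 => k _; rewrite divr_ge0 ?exprn_ge0.
Qed.

Lemma expR_trunc_le (n : nat) (y : R) : 0 <= y -> expR_trunc n y <= expR y.
Proof.
move=> y0; have c := @cvg_expR_trunc y.
rewrite -(cvg_lim _ c)//; apply: (@nondecreasing_cvgn_le _ (expR_trunc ^~ y)).
  apply/nondecreasing_seqP => k.
  by rewrite /expR_trunc big_nat_recr//= lerDl divr_ge0 ?exprn_ge0.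
by apply/cvg_ex; exists (expR y).
Qed.

(** Term by term, y^(n+k) / (n+k)! <= y^n y^k / k!. The factor e^y is harmless: before the saddle it
    costs only half of the decay of e^(- x xi). *)
Lemma expR_trunc_remainder (n : nat) (y : R) : 0 <= y ->
  expR y - expR_trunc n y <= y ^+ n * expR y.
Proof.
move=> y0; rewrite lerBlDl; have c := @cvg_expR_trunc y.
rewrite -{1}(cvg_lim _ c)//; apply: limr_le; first by apply/cvg_ex; exists (expR y).
near=> m.
have nm : (n <= m)%N by near: m; exact: nbhs_infty_ge.
rewrite /expR_trunc (big_cat_nat _ nm)//= lerD2l.
rewrite -{1}(add0n n) big_addn.
apply: (@le_trans _ _ (y ^+ n * expR_trunc (m - n) y)); last first.
  by rewrite ler_wpM2l ?exprn_ge0// expR_trunc_le.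
rewrite /expR_trunc mulr_sumr; apply: ler_sum => k _.
rewrite exprD mulrA (mulrC (y ^+ n)) ler_wpM2l ?mulr_ge0 ?exprn_ge0//.
by rewrite lef_pV2 ?posrE ?ltr0n ?fact_gt0// ler_nat leq_fact ?leq_addr.
Unshelve. all: by end_near. Qed.

(** Meant for the range beyond the saddle, where y = rho xi^2 >= M >= 1: there the truncated sum
    itself has the order y^n of the remainder on the other side. *)
Lemma expR_trunc_le_pow (n : nat) (y : R) : 1 <= y ->
  expR_trunc n y <= n%:R * y ^+ n.
Proof.
move=> y1; have y0 : 0 <= y by lra.
have -> : n%:R * y ^+ n = \sum_(0 <= k < n) y ^+ n.
  by rewrite sumr_const_nat subn0 mulr_natl.
apply: ler_sum_nat => k /andP[_ kn].
apply: (@le_trans _ _ (y ^+ k)); last by rewrite ler_weXn2l// ltnW.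
by rewrite ler_pdivrMr ?ltr0n ?fact_gt0// ler_peMr ?exprn_ge0// ler1n fact_gt0.
Qed.

(** As z^m / m! is one term of e^z, taking z = a u / 2 pays for the power with half of the
    exponential decay. *)
Lemma pow_expR_bound (m : nat) (a u : R) : 0 < a -> 0 <= u ->
  u ^+ m * expR (- (a * u)) <=
  m`!%:R * (2 / a) ^+ m * expR (- (a / 2 * u)).
Proof.
move=> a0 u0; pose z := a / 2 * u.
have z0 : 0 <= z by rewrite mulr_ge0// divr_ge0// ltW.
have hz : z ^+ m <= m`!%:R * expR z.
  rewrite mulrC -ler_pdivrMr ?ltr0n ?fact_gt0//.
  apply: le_trans (expR_trunc_le m.+1 z0).
  by rewrite /expR_trunc big_nat_recr//= lerDr expR_trunc_ge0.
have -> : u ^+ m * expR (- (a * u)) = (2 / a) ^+ m * (z ^+ m * expR (- (a * u))).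
  by rewrite mulrA -exprMn /z; congr (_ ^+ _ * _); field; rewrite gt_eqF.
rewrite [leRHS]mulrAC [leRHS]mulrC ler_wpM2l ?exprn_ge0 ?divr_ge0 ?(ltW a0)//.
have -> : - (a / 2 * u) = z - a * u by rewrite /z; field.
by rewrite expRD [leRHS]mulrA ler_wpM2r ?expR_ge0.
Qed.

Lemma coefC_integrable (k : nat) (x : R) : 0 < x ->
  mu.-integrable `[0, +oo[
    (EFin \o (fun xi => xi ^+ (2 * k) * expR (- (x * xi)) / Num.sqrt (1 + xi ^+ 2))).
Proof.
move=> x0.
have s0 (xi : R) : Num.sqrt (1 + xi ^+ 2) != 0.
  by rewrite sqrtr_eq0 -ltNge ltr_pwDl// sqr_ge0.
have s1 (xi : R) : 1 <= Num.sqrt (1 + xi ^+ 2).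
  by rewrite -{1}sqrtr1 ler_wsqrtr// lerDl sqr_ge0.
have [] // := @expR_dominated _ (fun xi => xi ^+ (2 * k) * expR (- (x * xi)) /
  Num.sqrt (1 + xi ^+ 2)) (x / 2) 0 ((2 * k)`!%:R * (2 / x) ^+ (2 * k)).
- by rewrite divr_gt0.
- by prove_continuous.
move=> u u0; rewrite subr0; apply: le_trans (pow_expR_bound _ x0 u0).
rewrite ger0_norm; last by rewrite !mulr_ge0 ?exprn_ge0 ?expR_ge0 ?invr_ge0.
rewrite ler_pdivrMr ?(lt_le_trans _ (s1 u))// ler_peMr//.
by rewrite mulr_ge0 ?exprn_ge0 ?expR_ge0.
Qed.

Section SaddleRemainder.
Variables (x rho : R) (p : nat).
Hypotheses (x0 : 0 < x) (rho0 : 0 < rho).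
Let M := bigM x rho.
Let n := p.+1.
Hypothesis M1 : 1 <= M.

(** The exponent is 2 n - 1, not 2 n, because one factor xi is spent on the square root. The
    quotient 2 / (x / 2) comes from [pow_expR_bound] at rate x / 2, which leaves the rate x / 4. *)
Let C := n%:R * rho ^+ n * ((2 * p).+1`!%:R * (2 / (x / 2)) ^+ (2 * p).+1).

Let weight xi : R := expR (- (x * xi)) / Num.sqrt (1 + xi ^+ 2).

(** Integrating at rate x / 4 supplies the missing power of 1 / x: rho^n (4 / x)^(2 n) is 4^n M^-n,
    and no other dependence on x or rho is left. *)
Let CE : C / (x / 2 / 2) = n%:R * (2 * p).+1`!%:R * 4 ^+ n * M ^- n.
Proof.
have xn0 : x != 0 by rewrite gt_eqF.
have rn0 : rho != 0 by rewrite gt_eqF.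
have -> : M ^- n = (4 * rho / x ^+ 2) ^+ n.
  by rewrite -exprVn /M /bigM; congr (_ ^+ _); field; rewrite xn0.
rewrite /C (_ : 2 / (x / 2) = 4 / x); last by field.
rewrite -[RHS]mulrA -exprMn.
rewrite (_ : 4 * (4 * rho / x ^+ 2) = rho * (4 / x) ^+ 2); last by field.
rewrite [in RHS]exprMn -[in RHS]exprM /n mulnS add2n (exprSr _ (2 * p).+1).
by field.
Qed.

(** The hypothesis on [w] suits both sides of the saddle: the Taylor remainder before it and the
    truncated sum beyond it. The gain of one power is the inequality xi / sqrt (1 + xi^2) <= 1. *)
Lemma saddle_weight_bound (xi w : R) : 0 <= xi ->
  `|w| <= n%:R * (rho * xi ^+ 2) ^+ n * expR (x / 2 * xi) ->
  `|w * weight xi| <= C * expR (- (x / 2 / 2 * xi)).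
Proof.
move=> xi0 hw.
have s0 : 0 < Num.sqrt (1 + xi ^+ 2) by rewrite sqrtr_gt0 ltr_pwDl// sqr_ge0.
have s1 : xi <= Num.sqrt (1 + xi ^+ 2).
  by rewrite -{1}(ger0_norm xi0) -sqrtr_sqr ler_wsqrtr// lerDr.
have W0 : 0 <= weight xi by rewrite /weight divr_ge0 ?expR_ge0 ?ltW.
rewrite normrM (ger0_norm W0); apply: le_trans (ler_wpM2r W0 hw) _.
have x20 : 0 < x / 2 by rewrite divr_gt0.
have np0 : 0 <= n%:R * rho ^+ n by rewrite mulr_ge0 ?exprn_ge0 ?(ltW rho0).
have := ler_wpM2l np0 (pow_expR_bound (2 * p).+1 x20 xi0).
move=> h; rewrite /C -[leRHS]mulrA; apply: (le_trans _ h).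
have -> : n%:R * (rho * xi ^+ 2) ^+ n * expR (x / 2 * xi) * weight xi =
    n%:R * rho ^+ n * (xi ^+ (2 * p).+1 * expR (- (x / 2 * xi)) *
      (xi / Num.sqrt (1 + xi ^+ 2))).
  have -> : - (x / 2 * xi) = x / 2 * xi - x * xi by field.
  rewrite /weight exprMn -exprM /n mulnS add2n expRD (exprSr xi (2 * p).+1).
  by field; rewrite gt_eqF.
rewrite ler_wpM2l// ler_piMr ?mulr_ge0 ?exprn_ge0 ?expR_ge0//.
by rewrite ler_pdivrMr// mul1r.
Qed.

Lemma saddle_remainder :
  `|\int[mu]_(xi in `[0, x / (2 * rho)])
      (expR (rho * xi ^+ 2 - x * xi) / Num.sqrt (1 + xi ^+ 2)) -
    \sum_(0 <= k < n) rho ^+ k / k`!%:R *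
      \int[mu]_(xi in `[0, +oo[)
        (xi ^+ (2 * k) * expR (- (x * xi)) / Num.sqrt (1 + xi ^+ 2))| <=
  2 * (n%:R * (2 * p).+1`!%:R * 4 ^+ n) * M ^- n.
Proof.
pose xi0 := x / (2 * rho).
have xi00 : 0 <= xi0 by rewrite divr_ge0 ?mulr_ge0 ?ltW.
have s0 (xi : R) : Num.sqrt (1 + xi ^+ 2) != 0.
  by rewrite sqrtr_eq0 -ltNge ltr_pwDl// sqr_ge0.
pose g k xi : R := rho ^+ k / k`!%:R *
  (xi ^+ (2 * k) * expR (- (x * xi)) / Num.sqrt (1 + xi ^+ 2)).
have gi k : mu.-integrable `[0, +oo[ (EFin \o g k).
  under [X in integrable _ _ X]eq_fun do rewrite /g /= EFinM.
  by apply: integrableZl => //; exact: coefC_integrable.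
have ET : (fun xi => expR_trunc n (rho * xi ^+ 2) * weight xi) =
    (fun xi => \sum_(0 <= k < n) g k xi).
  apply/funext => xi; rewrite /expR_trunc mulr_suml; apply: eq_bigr => k _.
  by rewrite /g /weight exprMn -exprM !mulrA; congr (_ * _ * _); rewrite mulrAC.
have ctrunc : continuous (fun xi : R => expR_trunc n (rho * xi ^+ 2)).
  by apply: continuous_expR_trunc; prove_continuous.
have cw : continuous weight by rewrite /weight; prove_continuous.
have Ti : mu.-integrable `[0, +oo[
    (EFin \o (fun xi => expR_trunc n (rho * xi ^+ 2) * weight xi)).
  rewrite ET.
  under [X in integrable _ _ X]eq_fun do rewrite /= -sumEFin.
  by apply: integrable_sum => // k _; exact: gi.
have -> : \sum_(0 <= k < n) rho ^+ k / k`!%:R *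
      \int[mu]_(xi in `[0, +oo[)
        (xi ^+ (2 * k) * expR (- (x * xi)) / Num.sqrt (1 + xi ^+ 2)) =
    \int[mu]_(xi in `[0, +oo[) (expR_trunc n (rho * xi ^+ 2) * weight xi).
  rewrite ET Rintegral_sum//; apply: eq_bigr => k _.
  by rewrite RintegralZl//; exact: coefC_integrable.
(* The integrals in C_k run to infinity while the saddle integral stops at [xi0]. The difference is
   the Taylor remainder on [0, xi0] minus the truncated sum beyond; each part is at most C / (x /
   4), hence the factor 2. *)
rewrite (Rintegral_itvy_split xi00 Ti) opprD addrA.
have -> : \int[mu]_(xi in `[0, x / (2 * rho)])
      (expR (rho * xi ^+ 2 - x * xi) / Num.sqrt (1 + xi ^+ 2)) -
    \int[mu]_(xi in `[0, xi0]) (expR_trunc n (rho * xi ^+ 2) * weight xi) =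
    \int[mu]_(xi in `[0, xi0])
      ((expR (rho * xi ^+ 2) - expR_trunc n (rho * xi ^+ 2)) * weight xi).
  rewrite -RintegralB//; last 2 first.
  - by apply: continuous_integrable; prove_continuous.
  - by apply: continuous_integrable; prove_continuous.
  by apply: eq_Rintegral => xi _; rewrite expRD /weight; ring.
apply: le_trans (ler_normB _ _) _.
rewrite -mulrA -CE mulr_natl mulr2n; have a0 : 0 < x / 2 / 2 by rewrite !divr_gt0.
apply: lerD.
  apply: expR_dominated_itv => //; first by prove_continuous.
  move=> xi /andP[l0 l1]; apply: saddle_weight_bound => //.
  have y0 : 0 <= rho * xi ^+ 2 by rewrite mulr_ge0 ?sqr_ge0 ?ltW.
  rewrite ger0_norm ?subr_ge0 ?expR_trunc_le//.
  apply: le_trans (expR_trunc_remainder n y0) _.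
  apply: ler_pM; rewrite ?exprn_ge0 ?expR_ge0//.
    by rewrite ler_peMl ?exprn_ge0// ler1n.
  rewrite ler_expR expr2 mulrA ler_wpM2r//.
  have := ler_wpM2l (ltW rho0) l1; rewrite /xi0.
  by have -> : rho * (x / (2 * rho)) = x / 2 by field; rewrite gt_eqF.
have [] // := @expR_dominated _ (fun xi => expR_trunc n (rho * xi ^+ 2) * weight xi)
  (x / 2 / 2) xi0 C a0; first by prove_continuous.
move=> xi l0; have xi1 : 0 <= xi by exact: le_trans l0.
apply: le_trans (saddle_weight_bound xi1 _) _; last first.
  have C0 : 0 <= C by rewrite /C !mulr_ge0 ?exprn_ge0 ?divr_ge0 ?ltW.
  by rewrite ler_wpM2l// ler_expR lerN2 ler_wpM2l ?(ltW a0)// lerBlDr lerDl.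
have y1 : 1 <= rho * xi ^+ 2.
  apply: le_trans M1 _.
  have -> : M = rho * xi0 ^+ 2.
    by rewrite /M /bigM /xi0; field; rewrite gt_eqF.
  by rewrite ler_wpM2l ?(ltW rho0)// ler_pXn2r// nnegrE.
have y0 : 0 <= rho * xi ^+ 2 by exact: le_trans y1.
rewrite ger0_norm ?expR_trunc_ge0//; apply: le_trans (expR_trunc_le_pow n y1) _.
rewrite ler_peMr ?mulr_ge0 ?exprn_ge0//.
by rewrite -expR0 ler_expR mulr_ge0// divr_ge0 ?ltW.
Qed.

End SaddleRemainder.
End Remainder.

(** * Gamma at half-integers *)

Section HalfIntegerGamma.
Context {R : realType}.
Local Notation mu := (@lebesgue_measure R).

(** Segments avoiding 0, where t^(-1/2) is singular. With endpoints that are k-th powers, squaring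
    maps [exhaust 1 n] onto [exhaust 2 n], so the substitution t = s^2 is made on compact sets and
    passed to the limit. *)
Definition exhaust (k n : nat) : set R :=
  `[(n.+1%:R ^+ k)^-1, n.+1%:R ^+ k]%classic.

Lemma bigcup_exhaust (k : nat) : (0 < k)%N ->
  \bigcup_n exhaust k n = `]0, +oo[%classic.
Proof.
move=> k0; apply/seteqP; split=> t.
  move=> [n _]; rewrite /exhaust /= !in_itv /= andbT => /andP[+ _].
  by apply: lt_le_trans; rewrite invr_gt0 exprn_gt0.
rewrite /= in_itv /= andbT => t0.
have [n hn] : exists n : nat, t + t^-1 < n.+1%:R.
  exists (Num.truncn (t + t^-1)).
  have h : 0 <= t + t^-1 by rewrite addr_ge0 ?invr_ge0 ?ltW.
  by have /andP[] := Num.Theory.truncn_itv h.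
have ti0 : 0 < t^-1 by rewrite invr_gt0.
have nk : (n.+1%:R : R) <= n.+1%:R ^+ k.
  by rewrite -{1}(expr1 n.+1%:R) ler_weXn2l// ler1n.
exists n => //; rewrite /exhaust /= in_itv /=; apply/andP; split; last by lra.
by rewrite -(invrK t) lef_pV2 ?posrE ?exprn_gt0//; lra.
Qed.

Lemma cvg_integral_exhaust (f : R -> R) (k : nat) : (0 < k)%N ->
  measurable_fun (`]0, +oo[%classic : set R) f -> (forall t, 0 < t -> 0 <= f t) ->
  (\int[mu]_(t in exhaust k n) (f t)%:E)%E @[n --> \oo] -->
  (\int[mu]_(t in `]0%R, +oo[) (f t)%:E)%E.
Proof.
move=> k0 mf f0; rewrite -(bigcup_exhaust k0).
have sub n : exhaust k n `<=` `]0, +oo[%classic.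
  by rewrite -(bigcup_exhaust k0); exact: bigcup_sup.
apply: ge0_nondecreasing_set_cvg_integral.
- move=> n m nm; apply/subsetPset; apply: subset_itv; rewrite bnd_simp.
    rewrite lef_pV2 ?posrE ?exprn_gt0// lerXn2r// ?nnegrE//.
    by rewrite ler_nat ltnS.
  by rewrite lerXn2r// ?nnegrE// ler_nat ltnS.
- by move=> n; exact: measurable_itv.
- by move=> n; apply/measurable_EFinP; apply: measurable_funS mf.
- by move=> n t /sub; rewrite /= in_itv /= andbT lee_fin; exact: f0.
Qed.

(* The substitution t = s ^+ 2 turns Gamma (m + 1/2) into the integral over
   [0, +oo[ of this function. *)
Definition gauss_moment (m : nat) (s : R) : R := 2 * s ^+ (2 * m) * expR (- s ^+ 2).

Lemma continuous_gauss_moment m : continuous (gauss_moment m).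
Proof. by rewrite /gauss_moment; prove_continuous. Qed.

Let kmoment (m n : nat) : R := \int[mu]_(s in exhaust 1 n) gauss_moment m s.

Let kmomentE m n :
  (\int[mu]_(s in exhaust 1 n) (gauss_moment m s)%:E)%E = (kmoment m n)%:E.
Proof.
rewrite /kmoment /Rintegral fineK//; apply: integrable_fin_num => //.
  exact: measurable_itv.
by apply: continuous_integrable; exact: continuous_gauss_moment.
Qed.

Lemma exhaust_gamma_substitution (m n : nat) :
  (\int[mu]_(t in exhaust 2 n) (t `^ (m%:R + 1 / 2 - 1) * expR (- t))%:E)%E =
  (\int[mu]_(s in exhaust 1 n) (gauss_moment m s)%:E)%E.
Proof.
pose G (t : R) := t `^ (m%:R + 1 / 2 - 1) * expR (- t).
pose N : R := n.+1%:R; have N1 : 1 <= N by rewrite ler1n.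
have N0 : 0 < N by lra.
have Ni0 : 0 < N^-1 by rewrite invr_gt0.
have NiN : N^-1 <= N by apply: (@le_trans _ _ 1) => //; rewrite invf_le1.
have dS (s : R) : is_derive s 1 (fun s => s ^+ 2) (2 * s).
  by prove_derive; rewrite mulr1.
have dSE := is_derive_derive1 dS.
have c2 : continuous (fun s : R => 2 * s) by prove_continuous.
rewrite /exhaust expr1 -/N -exprVn.
have := @integration_by_substitution_increasing R (fun s => s ^+ 2) G N^-1 N NiN.
rewrite dSE => ->.
- apply: eq_integral => s; rewrite inE /= in_itv /= => /andP[s1 _]; congr EFin.
  have s0 : 0 < s by exact: lt_le_trans s1.
  change (G (s ^+ 2) * (2 * s) = gauss_moment m s).
  rewrite /G /gauss_moment mulrAC; congr (_ * _).
  rewrite -(powR_mulrn 2 (ltW s0)) -powRrM -(powR_mulrn (2 * m) (ltW s0)).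
  rewrite mulrCA -{2}(powRr1 (ltW s0)) -powRD; last first.
    by rewrite (gt_eqF s0) implybT.
  by congr (_ * _ `^ _); rewrite natrM; field.
- move=> s t; rewrite !in_itv /= => /andP[s0 _] /andP[t0 _] st.
  by rewrite ltrXn2r// ?nnegrE ?ltW ?(lt_le_trans Ni0).
- by move=> s _; exact: c2.
- by apply/cvg_ex; eexists; apply: cvg_at_right_filter; exact: c2.
- by apply/cvg_ex; eexists; apply: cvg_at_left_filter; exact: c2.
- exact: is_derive_LRcontinuous dS.
- apply: derivable_within_continuous => t; rewrite in_itv /= => /andP[t1 _].
  have t0 : 0 < t by apply: lt_le_trans t1; rewrite exprn_gt0.
  have d1 := is_derive1_powR (m%:R + 1 / 2 - 1) t0.
  have d2 := is_derive_fun_expR (is_derive_fun_opp (is_derive_fun_id t)).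
  by have [] := is_derive_fun_mul d1 d2.
Qed.

Lemma cvg_gauss_moment_Gamma (m : nat) :
  (kmoment m n)%:E @[n --> \oo] -->
  (\int[mu]_(t in `]0%R, +oo[) (t `^ (m%:R + 1 / 2 - 1) * expR (- t))%:E)%E.
Proof.
have -> : (fun n => (kmoment m n)%:E) = fun n =>
    (\int[mu]_(t in exhaust 2 n) (t `^ (m%:R + 1 / 2 - 1) * expR (- t))%:E)%E.
  by apply/funext => n; rewrite exhaust_gamma_substitution kmomentE.
apply: cvg_integral_exhaust => //; last first.
  by move=> t t0; rewrite mulr_ge0 ?powR_ge0 ?expR_ge0.
apply: measurable_funM.
  by apply: measurable_funTS; exact: measurable_powR.
have ce : continuous (fun t : R => expR (- t)) by prove_continuous.
by apply: measurable_funTS; exact: continuous_measurable_fun ce.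
Qed.

(** Integration by parts on a segment: Gamma (a + 1) = a Gamma (a) at a = m + 1/2, up to boundary
    terms that vanish in the limit. *)
Let kmomentS (m n : nat) : kmoment m.+1 n =
  (m%:R + 1 / 2) * kmoment m n +
  (n.+1%:R^-1 ^+ (2 * m).+1 * expR (- (n.+1%:R^-1) ^+ 2) -
   n.+1%:R ^+ (2 * m).+1 * expR (- n.+1%:R ^+ 2)).
Proof.
pose H (s : R) := - (s ^+ (2 * m).+1 * expR (- s ^+ 2)).
have cg k := @continuous_gauss_moment k.
have dH (s : R) : is_derive s 1 H
    (gauss_moment m.+1 s - (m%:R + 1 / 2) * gauss_moment m s).
  rewrite /H /gauss_moment; prove_derive.
  rewrite mulnS add2n !exprS -[(2 * m).+1%:R]natr1 natrM.
  by field.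
have N1 : 1 <= n.+1%:R :> R by rewrite ler1n.
have NiN : n.+1%:R^-1 <= n.+1%:R :> R.
  by apply: (@le_trans _ _ 1) => //; rewrite invf_le1//; lra.
have cG : continuous (fun s =>
    gauss_moment m.+1 s - (m%:R + 1 / 2) * gauss_moment m s).
  have h1 := cg m; have h2 := cg m.+1.
  by prove_continuous.
have := Rintegral_FTC NiN cG dH.
rewrite /kmoment /exhaust expr1 RintegralB//; last 2 first.
- by apply: continuous_integrable; exact: cg.
- by apply: continuous_integrable; have h1 := cg m; prove_continuous.
rewrite RintegralZl//; last by apply: continuous_integrable; exact: cg.
by rewrite /H => h; lra.
Qed.

Let cvg_inv_nat : (n.+1%:R^-1 : R) @[n --> \oo] --> 0.
Proof. exact: cvg_harmonic. Qed.

Let cvg_kmoment_boundary (m : nat) :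
  ((n.+1%:R^-1 ^+ (2 * m).+1 * expR (- (n.+1%:R^-1) ^+ 2) -
   n.+1%:R ^+ (2 * m).+1 * expR (- n.+1%:R ^+ 2)) : R) @[n --> \oo] --> 0.
Proof.
rewrite -[X in _ --> X]subr0; apply: cvgB.
  apply: (@squeeze_cvgr _ _ _ _ (fun=> 0) (fun n => n.+1%:R^-1)).
  - apply: nearW => n.
    have i0 : 0 <= n.+1%:R^-1 :> R by rewrite invr_ge0.
    have i1 : n.+1%:R^-1 <= 1 :> R by rewrite invf_le1 ?ler1n.
    rewrite mulr_ge0 ?exprn_ge0 ?expR_ge0//= -[leRHS]mulr1.
    rewrite ler_pM ?exprn_ge0 ?expR_ge0//.
      by rewrite exprS ler_piMr// exprn_ile1.
  - exact: cvg_cst.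
  - exact: cvg_inv_nat.
(* By [pow_expR_bound] at rate 1, [c] bounds N^(2 m + 2) e^(- N) with N = n + 1. This is one power
   more than the boundary term has, which leaves c / N; and e^(- N^2) <= e^(- N). *)
pose c : R := ((2 * m).+2)`!%:R * (2 / 1) ^+ (2 * m).+2.
apply: (@squeeze_cvgr _ _ _ _ (fun=> 0) (fun n => c * n.+1%:R^-1)).
- apply: nearW => n.
  have N1 : 1 <= n.+1%:R :> R by rewrite ler1n.
  have N0 : 0 < n.+1%:R :> R by lra.
  rewrite mulr_ge0 ?exprn_ge0 ?expR_ge0//= ler_pdivlMr//.
  rewrite mulrAC -exprSr.
  apply: (@le_trans _ _ (n.+1%:R ^+ (2 * m).+2 * expR (- (1 * n.+1%:R)))).
    by rewrite ler_wpM2l ?exprn_ge0// ler_expR lerN2 mul1r expr2 ler_peMr// ltW.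
  apply: le_trans (pow_expR_bound _ (ltr01 : 0 < 1 :> R) (ltW N0)) _.
  have c0 : 0 <= c by rewrite /c mulr_ge0// exprn_ge0// divr_ge0.
  rewrite -[_ * _ ^+ _]/c -[leRHS]mulr1; apply: ler_wpM2l => //.
- exact: cvg_cst.
- rewrite -[X in _ --> X](mulr0 c); apply: cvgM; first exact: cvg_cst.
  exact: cvg_inv_nat.
Qed.

(** Gamma (m + 1/2), by the functional equation from Gamma (1/2) = sqrt pi. The arguments r + 1/2, k
    + 3/2 and k + r + 3/2 of the theorem all have this form. *)
Fixpoint half_gamma (m : nat) : R :=
  if m is m'.+1 then (m'%:R + 1 / 2) * half_gamma m' else Num.sqrt pi.

Lemma half_gammaS (m : nat) :
  half_gamma m.+1 = (m%:R + 1 / 2) * half_gamma m.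
Proof. by []. Qed.

Let cvg_kmoment (m : nat) : kmoment m n @[n --> \oo] --> half_gamma m.
Proof.
elim: m => [|m IH].
  have : (\int[mu]_(t in exhaust 1 n) (gauss_moment 0 t)%:E)%E @[n --> \oo] -->
      (\int[mu]_(t in `]0%R, +oo[) (gauss_moment 0 t)%:E)%E.
    apply: cvg_integral_exhaust => //.
      by apply: measurable_funTS; apply: continuous_measurable_fun;
        exact: continuous_gauss_moment.
    move=> t t0; rewrite /gauss_moment mulr_ge0 ?expR_ge0//.
    by rewrite mulr_ge0 ?exprn_ge0 ?(ltW t0).
  rewrite (_ : integral _ _ _ = (Num.sqrt pi)%:E); last first.
    rewrite integral_itv_obnd_cbnd; last first.
      by apply: continuous_measurable_EFin; exact: continuous_gauss_moment.
    under eq_integral do rewrite /gauss_moment muln0 expr0 mulr1 EFinM.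
    rewrite ge0_integralZl//; last first.
      by apply: continuous_measurable_EFin; exact: continuous_gauss_fun.
    rewrite -/(gauss_fun _).
    by rewrite integral0y_gauss -EFinM; congr EFin; field.
  by under eq_cvg do rewrite kmomentE; move/fine_cvg.
have := cvgD (cvgM (cvg_cst (m%:R + 1 / 2 : R)) IH) (@cvg_kmoment_boundary m).
rewrite addr0 => h.
rewrite (_ : kmoment m.+1 = fun n => (m%:R + 1 / 2) * kmoment m n +
  (n.+1%:R^-1 ^+ (2 * m).+1 * expR (- (n.+1%:R^-1) ^+ 2) -
   n.+1%:R ^+ (2 * m).+1 * expR (- n.+1%:R ^+ 2))); first exact: h.
by apply/funext => n; rewrite kmomentS.
Qed.

(** Both sides are limits of [kmoment m]: one by substitution and monotone convergence, the other by
    the recurrence. *)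
Lemma Gamma_half_integer (m : nat) : Gamma (m%:R + 1 / 2 : R) = half_gamma m.
Proof.
rewrite /Gamma /Rintegral.
have c : (kmoment m n)%:E @[n --> \oo] --> (half_gamma m)%:E.
  by apply: cvg_EFin; [exact: nearW|exact: cvg_kmoment].
by rewrite -(cvg_unique _ c (@cvg_gauss_moment_Gamma m)).
Qed.

Lemma half_gamma_gt0 (m : nat) : 0 < half_gamma m.
Proof.
by elim: m => [|m IH] /=; rewrite ?sqrtr_gt0 ?pi_gt0// mulr_gt0// ltr_wpDl.
Qed.

End HalfIntegerGamma.

(** * The Struve sum as an integral over the side u = 0 *)

Section StruveSum.
Context {R : realType}.
Local Notation mu := (@lebesgue_measure R).

Lemma bounded_cvg_Rintegral (h : nat -> R -> R) (f : R -> R) (a b C : R) :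
  (forall n, continuous (h n)) -> continuous f ->
  (forall n t, `|h n t| <= C) -> (forall t, h n t @[n --> \oo] --> f t) ->
  \int[mu]_(t in `[a, b]) h n t @[n --> \oo] --> \int[mu]_(t in `[a, b]) f t.
Proof.
move=> ch cf hC hf.
have mD : measurable (`[a, b]%classic : set R) by [].
have mh n : measurable_fun `[a, b] (EFin \o h n).
  by apply: continuous_measurable_EFin; exact: ch.
have mf : measurable_fun `[a, b] (EFin \o f) by exact: continuous_measurable_EFin.
have Ci : mu.-integrable `[a, b] (EFin \o (fun=> C)).
  by apply: continuous_integrable; exact: continuous_fun_cst.
have hfE : {ae mu, forall t, `[a, b]%classic t ->
    (EFin \o h n) t @[n --> \oo] --> (EFin \o f) t}.
  by apply: aeW => t _; apply: cvg_EFin; [exact: nearW|exact: hf].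
have hCE : {ae mu, forall t n, `[a, b]%classic t ->
    (`|(EFin \o h n) t| <= (EFin \o (fun=> C)) t)%E}.
  by apply: aeW => t n _; rewrite lee_fin.
have [_ _ c] := @dominated_convergence _ _ _ mu _ mD _ _ _ mh mf hfE Ci hCE.
apply: fine_cvg; rewrite fineK//.
by apply: integrable_fin_num => //; exact: continuous_integrable.
Qed.

Definition wallis (r k : nat) : R :=
  \int[mu]_(t in `[0, pi / 2]) (sin t ^+ (2 * r) * cos t ^+ (2 * k).+1).

Let pi20 : 0 <= pi / 2 :> R.
Proof. by rewrite divr_ge0 ?pi_ge0. Qed.

Lemma wallis0 r : wallis r 0 = (2 * r).+1%:R^-1.
Proof.
pose F (t : R) := sin t ^+ (2 * r).+1 / (2 * r).+1%:R.
have dF (t : R) : is_derive t 1 F (sin t ^+ (2 * r) * cos t ^+ (2 * 0).+1).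
  by rewrite /F; prove_derive; rewrite muln0 expr1; field.
have cf : continuous (fun t : R => sin t ^+ (2 * r) * cos t ^+ (2 * 0).+1).
  by prove_continuous.
rewrite /wallis (Rintegral_FTC pi20 cf dF) /F sin_pihalf sin0 expr1n expr0n.
by rewrite mul0r subr0 mul1r.
Qed.

(** Integrate the derivative of sin^(2r+1) cos^(2k+2), which vanishes at both ends, after replacing
    sin^2 by 1 - cos^2. *)
Lemma wallisS r k :
  (2 * r + 2 * k + 3)%:R * wallis r k.+1 = (2 * k + 2)%:R * wallis r k.
Proof.
pose f j (t : R) := sin t ^+ (2 * r) * cos t ^+ (2 * j).+1.
pose H (t : R) := sin t ^+ (2 * r).+1 * cos t ^+ (2 * k).+2.
have dH (t : R) : is_derive t 1 H
    ((2 * r + 2 * k + 3)%:R * f k.+1 t - (2 * k + 2)%:R * f k t).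
  rewrite /H /f; prove_derive; rewrite mulnS add2n.
  transitivity ((2 * r).+1%:R * (sin t ^+ (2 * r) * cos t ^+ (2 * k).+3) -
      (2 * k).+2%:R * (sin t ^+ 2 * (sin t ^+ (2 * r) * cos t ^+ (2 * k).+1))).
    by rewrite !exprS; ring.
  have -> : (2 * r).+1%:R = 2 * r%:R + 1 :> R by rewrite -addn1 natrD natrM.
  have -> : (2 * k).+2%:R = 2 * k%:R + 2 :> R by rewrite -addn2 natrD natrM.
  have -> : (2 * r + 2 * k + 3)%:R = 2 * r%:R + 2 * k%:R + 3 :> R.
    by rewrite 2!natrD 2!natrM.
  have -> : (2 * k + 2)%:R = 2 * k%:R + 2 :> R by rewrite natrD natrM.
  by rewrite sin2cos2 !exprS; ring.
have cf j : continuous (f j) by rewrite /f; prove_continuous.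
have cg : continuous (fun t =>
    (2 * r + 2 * k + 3)%:R * f k.+1 t - (2 * k + 2)%:R * f k t).
  by have h1 := cf k; have h2 := cf k.+1; prove_continuous.
have := Rintegral_FTC pi20 cg dH.
rewrite RintegralB//; last 2 first.
- by apply: continuous_integrable; have h2 := cf k.+1; prove_continuous.
- by apply: continuous_integrable; have h2 := cf k; prove_continuous.
rewrite !RintegralZl//; [|by apply: continuous_integrable; exact: cf..].
rewrite /H cos_pihalf sin0 !exprS !mul0r mulr0 subr0 => /eqP.
by rewrite subr_eq0 => /eqP.
Qed.

(** In terms of Gamma this is the Beta value of the Wallis integral combined with the duplication
    formula. Induction on k avoids both: from k to k + 1 each side is divided by (2 k + 3) (2 r + 2
    k + 3). *)
Lemma struve_coefficient (r k : nat) :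
  half_gamma r / half_gamma 0 *
    (2^-1 ^+ (2 * k).+1 / (half_gamma k.+1 * half_gamma (k + r).+1)) =
  2 / pi * (wallis r k / (2 * k).+1`!%:R) :> R.
Proof.
have g0 m : half_gamma m != 0 :> R by rewrite gt_eqF// half_gamma_gt0.
elim: k => [|k IH].
  rewrite wallis0 add0n muln0 expr1 (_ : 1`! = 1%N) ?divr1; last by [].
  have pi_sqr : pi = Num.sqrt pi ^+ 2 :> R by rewrite sqr_sqrtr ?pi_ge0.
  have h1 : half_gamma 1 = 2^-1 * Num.sqrt pi :> R by rewrite /= add0r mul1r.
  have hr := half_gammaS r.
  have h0 : half_gamma 0 = Num.sqrt pi :> R by [].
  have g0' := g0 0; rewrite h0 in g0' *.
  have r0 : (2 * r).+1%:R != 0 :> R by [].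
  have -> : (2 * r).+1%:R = 2 * (r%:R + 1 / 2) :> R.
    by rewrite -addn1 natrD natrM; field.
  have r1 : r%:R + 1 / 2 != 0 :> R by rewrite gt_eqF// ltr_wpDl.
  rewrite h1 hr; move: g0' pi_sqr; generalize (Num.sqrt (pi : R)) => s s0 ->.
  have r2 : r%:R * 2 + 1 != 0 :> R by rewrite gt_eqF// ltr_wpDl ?mulr_ge0.
  by field; rewrite r2 s0 g0.
have hk : half_gamma k.+2 = (k%:R + 3 / 2) * half_gamma k.+1 :> R.
  by rewrite half_gammaS -addn1 natrD; congr (_ * _); field.
have hkr : half_gamma (k.+1 + r).+1 =
    (k%:R + r%:R + 3 / 2) * half_gamma (k + r).+1 :> R.
  by rewrite addSn half_gammaS -(addn1 (k + r)) 2!natrD; congr (_ * _); field.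
have wk : wallis r k.+1 = (2 * k%:R + 2) / (2 * r%:R + 2 * k%:R + 3) * wallis r k.
  have := wallisS r k; rewrite 2!natrD [(_ + 2)%:R]natrD !natrM => h.
  have d0 : 2 * r%:R + 2 * k%:R + 3 != 0 :> R by rewrite gt_eqF// ltr_wpDl ?addr_ge0.
  by apply: (mulfI d0); rewrite h; field.
have fk : (2 * k.+1).+1`!%:R =
    (2 * k%:R + 3) * (2 * k%:R + 2) * (2 * k).+1`!%:R :> R.
  rewrite mulnS add2n 2!factS !natrM.
  have -> : (2 * k).+3%:R = 2 * k%:R + 3 :> R by rewrite -addn3 natrD natrM.
  have -> : (2 * k).+2%:R = 2 * k%:R + 2 :> R by rewrite -addn2 natrD natrM.
  by rewrite mulrA.
have e2 : 2^-1 ^+ (2 * k.+1).+1 = 2^-1 ^+ (2 * k).+1 / 4 :> R.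
  by rewrite mulnS add2n !exprS; field.
have f0 : (2 * k).+1`!%:R != 0 :> R by rewrite pnatr_eq0 -lt0n fact_gt0.
rewrite hk hkr wk fk e2.
have a0 : k%:R + r%:R + 3 / 2 != 0 :> R by rewrite gt_eqF// ltr_wpDl ?addr_ge0.
have a1 : k%:R + 3 / 2 != 0 :> R by rewrite gt_eqF// ltr_wpDl ?addr_ge0.
have a2 : 2 * k%:R + 2 != 0 :> R by rewrite gt_eqF// ltr_wpDl ?addr_ge0.
have a3 : 2 * k%:R + 3 != 0 :> R by rewrite gt_eqF// ltr_wpDl ?addr_ge0.
have a4 : 2 * r%:R + 2 * k%:R + 3 != 0 :> R by rewrite gt_eqF// ltr_wpDl ?addr_ge0.
transitivity (half_gamma r / half_gamma 0 *
    (2^-1 ^+ (2 * k).+1 / (half_gamma k.+1 * half_gamma (k + r).+1)) /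
    ((2 * k%:R + 3) * (2 * r%:R + 2 * k%:R + 3)) : R).
  by field; rewrite a3 a4 !g0.
have p0 : pi != 0 :> R by rewrite gt_eqF// pi_gt0.
rewrite IH; move: p0; generalize (pi : R) => c c0.
by field; rewrite a2 a3 a4 f0 c0.
Qed.

(** In absolute value, n terms of the sine series are the odd ones among the first 2 n terms of
    e^|y|. This dominates the partial sums in [scaled_struveE]. *)
Lemma sin_coeff'_trunc_bound (n : nat) (y z : R) : `|y| <= z ->
  `|series (sin_coeff' y) n| <= expR z.
Proof.
move=> yz; apply: (@le_trans _ _ (expR `|y|)); last by rewrite ler_expR.
apply: (@le_trans _ _ (expR_trunc (2 * n) `|y|)); last exact: expR_trunc_le.
elim: n => [|n IH].
  by rewrite /series /= big_nil normr0 expR_trunc_ge0.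
rewrite /series /= big_nat_recr//= mulnS add2n /expR_trunc !big_nat_recr//=.
apply: le_trans (ler_normD _ _) _; rewrite -addrA lerD//.
rewrite /sin_coeff' -exprnP !normrM normfV normrX normrN1 expr1n mul1r.
rewrite [`|y ^+ _|]normrX [`|_%:R|]ger0_norm// mul2n -addnn mulrC.
by rewrite lerDr divr_ge0 ?exprn_ge0.
Qed.

(** Poisson's integral for the Struve function, whose normalising factor Gamma (r + 1/2) is
    cancelled by (1/2)_r. It follows by expanding the sine and integrating term by term. *)
Lemma scaled_struveE (r : nat) (x : R) : 0 < x ->
  pochhammer (1 / 2) r * scaled_struve r%:R x =
  2 / pi * \int[mu]_(t in `[0, pi / 2]) (sin t ^+ (2 * r) * sin (x * cos t)).
Proof.
move=> x0.
pose q : R := half_gamma r / half_gamma 0.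
have q0 : q != 0 by rewrite gt_eqF// divr_gt0 ?half_gamma_gt0.
have -> : pochhammer (1 / 2) r = q.
  rewrite /pochhammer /q -!Gamma_half_integer add0r.
  by congr (Gamma _ / _); rewrite addrC.
set I := \int[mu]_(t in _) _.
(* [limn] has a meaning only for a convergent sequence, so the Struve series is shown to converge to
   its value; the Pochhammer factor moves to the other side as [q^-1]. *)
suff : series (fun k : nat => (-1) ^+ k * (x / 2) ^+ (2 * k + 1) /
      (Gamma (k%:R + 3 / 2) * Gamma (k%:R + r%:R + 3 / 2))) n
    @[n --> \oo] --> q^-1 * (2 / pi * I).
  by move=> c; rewrite /scaled_struve (cvg_lim _ c)// mulVKf.
pose h n (t : R) := sin t ^+ (2 * r) * series (sin_coeff' (x * cos t)) n.
have hE n : series (fun k : nat => (-1) ^+ k * (x / 2) ^+ (2 * k + 1) /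
      (Gamma (k%:R + 3 / 2) * Gamma (k%:R + r%:R + 3 / 2))) n =
    q^-1 * (2 / pi * \int[mu]_(t in `[0, pi / 2]) h n t).
  have -> : \int[mu]_(t in `[0, pi / 2]) h n t = \sum_(0 <= k < n)
      (-1) ^+ k * x ^+ (2 * k).+1 * (wallis r k / (2 * k).+1`!%:R).
    transitivity (\int[mu]_(t in `[0, pi / 2]) \sum_(0 <= k < n)
        ((-1) ^+ k * x ^+ (2 * k).+1 / (2 * k).+1`!%:R *
          (sin t ^+ (2 * r) * cos t ^+ (2 * k).+1))).
      apply: eq_Rintegral => t _; rewrite /h /series /= mulr_sumr.
      apply: eq_bigr => k _; rewrite /sin_coeff' -exprnP -mul2n exprMn.
      by field; rewrite pnatr_eq0 -lt0n fact_gt0.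
    rewrite Rintegral_sum//; last first.
      by move=> k; apply: continuous_integrable; prove_continuous.
    apply: eq_bigr => k _; rewrite RintegralZl//; last first.
      by apply: continuous_integrable; prove_continuous.
    by rewrite -/(wallis r k) mulrAC mulrA.
  rewrite !mulr_sumr; apply: eq_bigr => k _.
  have -> : k%:R + 3 / 2 = k.+1%:R + 1 / 2 :> R by rewrite -addn1 natrD; field.
  have -> : k%:R + r%:R + 3 / 2 = (k + r).+1%:R + 1 / 2 :> R.
    by rewrite -[(k + r).+1]addn1 2!natrD; field.
  rewrite !Gamma_half_integer addn1.
  have := struve_coefficient r k; rewrite -/q => sc.
  rewrite [RHS](_ : _ = q^-1 * ((-1) ^+ k * x ^+ (2 * k).+1) *
    (2 / pi * (wallis r k / (2 * k).+1`!%:R))); last by rewrite mulrCA -!mulrA; ring.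
  by rewrite -sc exprMn [RHS]mulrACA mulVf// mul1r !mulrA.
rewrite (_ : series _ = fun n => q^-1 * (2 / pi *
  \int[mu]_(t in `[0, pi / 2]) h n t)); last by apply/funext.
apply: cvgM; first exact: cvg_cst; apply: cvgM; first exact: cvg_cst.
apply: (@bounded_cvg_Rintegral h _ _ _ (expR x)).
- move=> n; rewrite /h; apply: continuous_fun_mul; first by prove_continuous.
  elim: n => [|n IH].
    rewrite (_ : (fun _ => _) = fun=> 0); first exact: continuous_fun_cst.
    by apply/funext => t; rewrite /series /= big_nil.
  rewrite (_ : (fun _ => _) = fun t => series (sin_coeff' (x * cos t)) n +
    (-1) ^+ n * (x * cos t) ^+ n.*2.+1 / n.*2.+1`!%:R).
    by apply: continuous_fun_add => //; prove_continuous.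
  apply/funext => t; rewrite /series /= big_nat_recr//=; congr (_ + _).
- by prove_continuous.
- move=> n t; rewrite /h normrM -[leRHS]mul1r ler_pM//.
    by rewrite normrX exprn_ile1// ler_norml sin_geN1 sin_le1.
  apply: sin_coeff'_trunc_bound; rewrite normrM gtr0_norm// ler_piMr ?(ltW x0)//.
  by rewrite ler_norml cos_geN1 cos_le1.
- move=> t; apply: cvgM; first exact: cvg_cst.
  exact: cvg_sin_coeff'.
Qed.

(** Once each Struve function is an integral over t, the sum over r is the exponential series of rho
    sin(t)^2 under the integral sign. *)
Lemma struve_sum (x rho : R) : 0 < x -> 0 < rho ->
  limn (series (fun r : nat =>
    pochhammer (1 / 2) r / r`!%:R * rho ^+ r * scaled_struve r%:R x)) =
  2 / pi * \int[mu]_(t in `[0, pi / 2]) (expR (rho * sin t ^+ 2) * sin (x * cos t)).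
Proof.
move=> x0 rho0.
pose h n (t : R) := expR_trunc n (rho * sin t ^+ 2) * sin (x * cos t).
have hE n : series (fun r : nat =>
      pochhammer (1 / 2) r / r`!%:R * rho ^+ r * scaled_struve r%:R x) n =
    2 / pi * \int[mu]_(t in `[0, pi / 2]) h n t.
  have -> : \int[mu]_(t in `[0, pi / 2]) h n t = \sum_(0 <= r < n)
      rho ^+ r / r`!%:R *
      \int[mu]_(t in `[0, pi / 2]) (sin t ^+ (2 * r) * sin (x * cos t)).
    transitivity (\int[mu]_(t in `[0, pi / 2]) \sum_(0 <= r < n)
        (rho ^+ r / r`!%:R * (sin t ^+ (2 * r) * sin (x * cos t)))).
      apply: eq_Rintegral => t _; rewrite /h /expR_trunc mulr_suml.
      apply: eq_bigr => r _; rewrite exprMn exprM.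
      by field; rewrite pnatr_eq0 -lt0n fact_gt0.
    rewrite Rintegral_sum//; last first.
      by move=> k; apply: continuous_integrable; prove_continuous.
    apply: eq_bigr => k _; rewrite RintegralZl//.
    by apply: continuous_integrable; prove_continuous.
  rewrite mulr_sumr; apply: eq_bigr => r _.
  rewrite mulrCA -scaled_struveE//; ring.
rewrite (_ : series _ = fun n => 2 / pi *
  \int[mu]_(t in `[0, pi / 2]) h n t); last by apply/funext.
apply/cvg_lim => //; apply: cvgM; first exact: cvg_cst.
apply: (@bounded_cvg_Rintegral h _ _ _ (expR rho)).
- move=> n; rewrite /h; apply: continuous_fun_mul; last by prove_continuous.
  by apply: continuous_expR_trunc; prove_continuous.
- by prove_continuous.
- move=> n t; rewrite /h normrM -[leRHS]mulr1 ler_pM//; last first.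
    by rewrite ler_norml sin_geN1 sin_le1.
  have y0 : 0 <= rho * sin t ^+ 2 by rewrite mulr_ge0 ?sqr_ge0 ?(ltW rho0).
  rewrite ger0_norm ?expR_trunc_ge0//; apply: le_trans (expR_trunc_le n y0) _.
  rewrite ler_expR ler_piMr ?(ltW rho0)// -sqr_normr exprn_ile1//.
- move=> t; apply: cvgM; last exact: cvg_cst.
  exact: cvg_expR_trunc.
Qed.

End StruveSum.

(** * Assembling the expansion with its error bound *)

Section SaddleExpansion.
Context {R : realType}.
Local Notation mu := (@lebesgue_measure R).

Lemma expRN_le_pow (n : nat) (M : R) : 0 < M -> expR (- M) <= n`!%:R * M ^- n.
Proof.
move=> M0; have f0 : 0 < n`!%:R :> R by rewrite ltr0n fact_gt0.
rewrite expRN -lef_pV2 ?posrE ?divr_gt0 ?exprn_gt0 ?invr_gt0 ?expR_gt0//.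
rewrite invrK invfM invrK mulrC; apply: le_trans (expR_trunc_le n.+1 (ltW M0)).
by rewrite /expR_trunc big_nat_recr//= lerDr expR_trunc_ge0 ?ltW.
Qed.

(** Since M^-k = (4 rho)^k / x^(2 k), the powers of x and 4 cancel and what remains is the k-th
    Taylor term of e^(rho xi^2), integrated. *)
Lemma coefC_term (k : nat) (x rho : R) : 0 < x -> 0 < rho ->
  bigM x rho ^- k / (2 ^+ (2 * k) * k`!%:R) * coefC k x =
  2 / pi * (rho ^+ k / k`!%:R * \int[mu]_(xi in `[0, +oo[)
    (xi ^+ (2 * k) * expR (- (x * xi)) / Num.sqrt (1 + xi ^+ 2))).
Proof.
move=> x0 rho0; rewrite /coefC; set I := Rintegral _ _ _.
have x0' : x != 0 by rewrite gt_eqF.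
have r0' : rho != 0 by rewrite gt_eqF.
have e : bigM x rho ^- k * x ^+ (2 * k) = 2 ^+ (2 * k) * rho ^+ k.
  rewrite !exprM -exprVn -!exprMn; congr (_ ^+ _).
  by rewrite /bigM; field; rewrite ?x0' ?r0'.
transitivity (2 / pi * ((bigM x rho ^- k * x ^+ (2 * k)) /
    (2 ^+ (2 * k) * k`!%:R) * I)).
  by rewrite -!mulrA; generalize (pi : R)^-1 => c; ring.
rewrite e; congr (_ * (_ * _)).
by rewrite invfM mulrACA divff ?expf_neq0// mul1r.
Qed.

(** The left side is the theorem's equation solved for the error inside the braces. In the constant,
    the first summand is that of [saddle_remainder]; the second bounds [E] by 1 / (2 M) <= 1 and
    e^(- M) <= n! M^-n, where n = p + 1. *)
Lemma F0_expansion (p : nat) (x rho : R) : 0 < x -> 0 < rho -> 1 <= bigM x rho ->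
  `|(F0 x rho + pi * expR (- (rho / 2)) *
      limn (series (fun r : nat =>
        pochhammer (1 / 2) r / r`!%:R * rho ^+ r * scaled_struve r%:R x))) /
    (pi * expR (rho / 2)) -
    \sum_(0 <= k < p.+1) bigM x rho ^- k / (2 ^+ (2 * k) * k`!%:R) * coefC k x| <=
  2 / pi * (2 * (p.+1%:R * (2 * p).+1`!%:R * 4 ^+ p.+1) + (pi / 2 + 1) * p.+1`!%:R) *
    bigM x rho ^- p.+1.
Proof.
move=> x0 rho0 M1; set M := bigM x rho.
have M1' : 1 <= M by [].
have M0 : 0 < M by rewrite (lt_le_trans _ M1).
(* V is arsinh (x / (2 rho)). With [s] the square root, (s + z) (s - z) = 1 gives e^(- V) = s - z
   and hence sinh V = z. *)
pose V := ln (x / (2 * rho) + Num.sqrt (1 + (x / (2 * rho)) ^+ 2)).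
set z := x / (2 * rho) in V *.
have z0 : 0 < z by rewrite divr_gt0 ?mulr_gt0.
pose s := Num.sqrt (1 + z ^+ 2).
have s2 : s ^+ 2 = 1 + z ^+ 2 by rewrite sqr_sqrtr// addr_ge0 ?sqr_ge0.
have s1 : 1 <= s by rewrite -{1}sqrtr1 ler_wsqrtr// lerDl sqr_ge0.
have sz0 : 0 < z + s by lra.
have eV : expR V = z + s by rewrite lnK.
have eNV : expR (- V) = s - z.
  rewrite expRN eV; apply: (mulfI (_ : z + s != 0)); first by rewrite gt_eqF//; lra.
  rewrite divff; last by rewrite gt_eqF//; lra.
  by rewrite mulrC [z + s]addrC -subr_sqr s2; ring.
have V0 : 0 <= V by apply: ln_ge0; rewrite -/s; lra.
have sV : sinh V = z by rewrite /sinh eV eNV; field.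
have [E EM ->] := F0_saddle x0 rho0 V0 sV.
rewrite struve_sum// -/z.
rewrite (eq_bigr (fun k => 2 / pi * (rho ^+ k / k`!%:R * \int[mu]_(xi in `[0, +oo[)
    (xi ^+ (2 * k) * expR (- (x * xi)) / Num.sqrt (1 + xi ^+ 2))))); last first.
  by move=> k _; exact: coefC_term.
rewrite -mulr_sumr.
have := saddle_remainder p x0 rho0 M1; rewrite -/z -/M.
set T := \sum_(0 <= k < p.+1) _; set I1 := Rintegral _ _ _; set J := Rintegral _ _ _.
set c := expR (rho / 2); have c0 : 0 < c by exact: expR_gt0.
set d := expR (- (rho / 2)) => DM.
have pi0 := pi_gt0 R.
(* The two multiples of [J] cancel exactly: this is the side u = 0 against the Struve sum. *)
have -> : (2 * (c * I1 - d * J + E) + pi * d * (2 / pi * J)) / (pi * c) -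
    2 / pi * T =
    2 / pi * ((I1 - T) + E / c).
  move: pi0; generalize (pi : R) => q q0; field.
  by rewrite !gt_eqF.
rewrite normrM ger0_norm ?divr_ge0 ?(ltW pi0)// -mulrA.
rewrite ler_wpM2l ?divr_ge0 ?(ltW pi0)//.
apply: le_trans (ler_normD _ _) _; rewrite mulrDl lerD//.
rewrite normrM normfV (gtr0_norm c0) ler_pdivrMr//; apply: le_trans EM _.
rewrite -/c -[leLHS]mulrA [leRHS]mulrC ler_wpM2l ?(ltW c0)//.
have h : (2 * M)^-1 <= 1 by rewrite invf_le1; lra.
have i0 : 0 <= (2 * M)^-1 by rewrite invr_ge0; lra.
rewrite mulrC -[leRHS]mulrA; apply: ler_pM.
- by rewrite addr_ge0 ?divr_ge0 ?(ltW pi0).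
- exact: expR_ge0.
- by rewrite lerD2l.
- exact: expRN_le_pow.
Qed.

End SaddleExpansion.

Theorem theorem1 (R : realType) (B : R) (n : nat) (hB : 0 < B) (hn : (1 <= n)%N) :
  exists E1 E2 E3 : R -> R -> R,
    [/\ isO n B (fun M => M ^- n) E1,
        isO n B (fun M => expR (- M)) E2,
        isO n B (fun M => M^-1 * expR (- M)) E3 &
        forall x rho : R, 0 < x < B -> 0 < rho < B -> n%:R < bigM x rho ->
          F0 x rho =
            - pi * expR (- (rho / 2)) *
              limn (series (fun r : nat =>
                pochhammer (1 / 2) r / r`!%:R * rho ^+ r * scaled_struve r%:R x))
            + pi * expR (rho / 2) *
              (\sum_(0 <= k < n)
                 bigM x rho ^- k / (2 ^+ (2 * k) * k`!%:R) * coefC k x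
               + E1 x rho)
            + E2 x rho + E3 x rho].
Proof.
have zeroO (g : R -> R) : (forall M, 0 < M -> 0 <= g M) -> isO n B g (fun _ _ => 0).
  move=> g0; exists 1, n.+1%:R; split; [by []|by rewrite ltr_nat|].
  by move=> x rho _ _ nM; rewrite normr0 mul1r g0// (lt_le_trans _ nM).
(* [E1] is defined as the exact error, so the equation holds by rearrangement and only the bound on
   [E1] carries content. *)
exists (fun x rho => (F0 x rho + pi * expR (- (rho / 2)) *
      limn (series (fun r : nat =>
        pochhammer (1 / 2) r / r`!%:R * rho ^+ r * scaled_struve r%:R x))) /
    (pi * expR (rho / 2)) -
    \sum_(0 <= k < n) bigM x rho ^- k / (2 ^+ (2 * k) * k`!%:R) * coefC k x),
  (fun _ _ => 0), (fun _ _ => 0); split.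
- case: n hn {zeroO} => // p _.
  (* The threshold [p.+2%:R] is n + 1, as it must exceed n; it also ensures M >= 1. *)
  exists (2 / pi * (2 * (p.+1%:R * (2 * p).+1`!%:R * 4 ^+ p.+1) +
    (pi / 2 + 1) * p.+1`!%:R)), p.+2%:R; split.
  + have pi0 := pi_gt0 R.
    rewrite mulr_gt0 ?divr_gt0// addr_gt0 ?mulr_gt0 ?exprn_gt0 ?ltr0n ?fact_gt0//.
    by rewrite addr_gt0 ?divr_gt0.
  + by rewrite ltr_nat.
  + move=> x rho /andP[x0 _] /andP[rho0 _] M2; apply: F0_expansion => //.
    by apply: le_trans M2; rewrite ler1n.
- by apply: zeroO => M _; exact: expR_ge0.
- by apply: zeroO => M M0; rewrite mulr_ge0 ?expR_ge0 ?invr_ge0 ?ltW.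
- move=> x rho _ _ _; rewrite !addr0 [_ + (_ - _)]addrC subrK.
  rewrite [_ * (_ / _)]mulrC divfK; first by rewrite !mulNr addrC addrK.
  by rewrite gt_eqF// mulr_gt0 ?pi_gt0 ?expR_gt0.
Qed.
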